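(* Let $g\in C_b([0,T)\times[0,\infty)\times\mathbb{R}\times\mathbb{R})$. For any $(t^*,y^* )\in(0,T)\times\mathbb{R}$, $$\lim_{\substack{(t,x,y)\to(t^*,0,y^* )\\(t,x,y)\in\mathcal{D}^\circ}}\int_{0}^t\int_{\mathbb{R}}\mathcal{K}^\partial_{y_\circ}(s,x,y)\,g(s,x,y,y_\circ)\,dy_\circ\,ds=g(0,0,y^*,y^* )+\int_0^{t^*}\int_{\mathbb{R}}\mathcal{K}^\partial_{y_\circ}(s,0,y^* )\,g(s,0,y^*,y_\circ)\,dy_\circ\,ds .$$
   Context: Fix $T>0$; $\mathcal{D}^\circ=(0,T)\times(0,\infty)\times\mathbb{R}$, $\mathcal{U}=(0,T)\times\mathbb{R}\times\mathbb{R}$. $C_b(S)$ is the space of bounded continuous real functions on $S$. Standing assumptions. $b_1,b_2,c:\mathbb{R}^2\to\mathbb{R}$ are infinitely differentiable, bounded with all derivatives bounded. $C_1>0$ is a constant with $|\partial_x^i\partial_y^jb_1|\le C_1$ for $i+j\le3$, $|\partial_x^i\partial_y^jb_2|\le C_1$ for $i+j\le1$, $|c|\le C_1$ on $\mathbb{R}^2$. $\mathfrak{B}:=\partial b_1/\partial y>0$ on $\mathbb{R}^2$, and $\underline b:=\inf_{y\in\mathbb{R}}\{-b_1(0,y)\}>0$. $C_2>0$ is a constant with $|\partial_x^i\partial_y^jb_1(x,y)|\le C_2\mathfrak{B}(x,y)$ for all $(x,y)\in\mathbb{R}^2$ and $1\le i+j\le3$. Kernel. For $(x_\circ,y_\circ)\in\mathbb{R}^2$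 and $(t,x,y)\in\mathcal{U}$, with $b_1,b_2,\mathfrak{B}$ evaluated at $(x_\circ,y_\circ)$, set $X=\frac{x-x_\circ+b_1t}{\mathfrak{B}t^{3/2}}-\frac12b_2t^{1/2}$, $Y=\frac{y-y_\circ}{t^{1/2}}+b_2t^{1/2}$, and $\mathcal{K}_{x_\circ,y_\circ}(t,x,y)=\frac{\sqrt{12}}{2\pi\mathfrak{B}t^2}\exp[-(6X^2+6XY+2Y^2)]$. The approximate boundary potential is $\mathcal{K}^\partial_{y_\circ}(t,x,y)=|b_1(0,y_\circ)|\,\mathcal{K}_{0,y_\circ}(t,x,y)$. *)

(* Defs.v *)
From HB Require Import structures.
From mathcomp Require Import all_boot all_order all_algebra.
From mathcomp Require Import all_classical all_reals all_analysis.

Set Implicit Arguments.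
Unset Strict Implicit.
Unset Printing Implicit Defensive.

Import Order.TTheory GRing.Theory Num.Theory.
Import numFieldNormedType.Exports.

Local Open Scope classical_set_scope.
Local Open Scope ring_scope.

Section Smooth.
Context {R : realType}.
Implicit Types (f : R * R -> R) (p : R * R).

Definition pdx f : R * R -> R := fun p => 'D_((1, 0) : R * R) f p.
Definition pdy f : R * R -> R := fun p => 'D_((0, 1) : R * R) f p.

Definition pd (i j : nat) f : R * R -> R := iter i pdx (iter j pdy f).

Fixpoint Cn (n : nat) f : Prop :=
  if n is m.+1
  then [/\ forall p, differentiable f p, Cn m (pdx f) & Cn m (pdy f)]
  else continuous f.

Definition Cinfty f : Prop := forall n, Cn n f.

Definition Cinfty_bounded f : Prop :=
  Cinfty f /\ forall i j, [bounded pd i j f p | p in [set: R * R]].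

End Smooth.

(* [S] need not be open: continuity is for the subspace topology, and the
   values of [h] outside [S] are irrelevant. *)
Definition Cb {R : realType} {U : topologicalType} (S : set U) (h : U -> R) :
    Prop :=
  {within S, continuous h} /\ [bounded h p | p in S].

Section Kernel.
Context {R : realType}.
Variables b1 b2 : R * R -> R.

Definition kerX (q : R * R) (t x : R) : R :=
  (x - q.1 + b1 q * t) / (pdy b1 q * t `^ (3 / 2))
  - 1 / 2 * b2 q * t `^ (1 / 2).

Definition kerY (q : R * R) (t y : R) : R :=
  (y - q.2) / t `^ (1 / 2) + b2 q * t `^ (1 / 2).

Definition kernel (q : R * R) (t x y : R) : R :=
  let X := kerX q t x in
  let Y := kerY q t y in
  Num.sqrt 12 / (2 * pi * pdy b1 q * t ^+ 2)
  * expR (- (6 * X ^+ 2 + 6 * X * Y + 2 * Y ^+ 2)).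

Definition boundary_kernel (yo t x y : R) : R :=
  `|b1 (0, yo)| * kernel (0, yo) t x y.

End Kernel.

(* Well-definedness of the iterated integral of [F s y] over y in R, then over
   s in ]0, t[: [Rintegral] is a total operator, so it does not carry this. *)
Definition iterated_integrable {R : realType} (t : R) (F : R -> R -> R) : Prop :=
  let mu := @lebesgue_measure R in
  (forall s, 0 < s < t -> mu.-integrable setT (EFin \o F s)) /\
  mu.-integrable `]0, t[
    (EFin \o (fun s => \int[mu]_(y in setT) F s y)).

(* Main.v *)
Require Import Defs.
From HB Require Import structures.
From mathcomp Require Import all_boot all_order all_algebra.
From mathcomp Require Import all_classical all_reals all_analysis.
From mathcomp Require Import measurable_realfun ring lra.

Set Implicit Arguments.
Unset Strict Implicit.
Unset Printing Implicit Defensive.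

Import Order.TTheory GRing.Theory Num.Theory.
Import numFieldNormedType.Exports.

Local Open Scope classical_set_scope.
Local Open Scope ring_scope.

(** Write [a = - b1 (0, .)], [B] for the derivative of [b1] in [y] on the axis
    [x = 0], and [s], [yo] for the integration variables. The exponent of the
    kernel is a positive definite quadratic form in
    [p = (x - a yo * s) / (B yo * s `^ (3 / 2))] and [q = (y - yo) / s `^ (1 / 2)],
    up to a drift that contributes a bounded factor ([qform_ge],
    [potential_le_gauss]). As [x] tends to [0] the integral splits in two.

    Away from the characteristic, where [s / x] is outside a compact interval around
    [1 / a], one has [|x - a yo * s| >= c * s], so that [p ^+ 2] is at least of
    order [1 / (B yo ^+ 2 * s)]. This makes the exponential smaller than any power
    of [B yo ^+ 2 * s] and beats the prefactor [1 / (B yo * s ^+ 2)]: the kernel is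
    bounded by a Gaussian in [yo], uniformly in [x >= 0] and in bounded times
    ([potential_far]). Dominated convergence gives the integral at [x = 0]
    ([far_limit]).

    Around the characteristic, the substitution
    [s = x * (1 + x `^ (1 / 2) * u) / a y], [yo = y + x `^ (1 / 2) * v] has a
    Jacobian that cancels all powers of [x] ([potential_rescaled]). Since
    [a yo - a y] is [- B] at an intermediate point times [yo - y], the rescaled
    potential converges to a Gaussian density in [(u, v)], of total mass one
    ([Rintegral_profile]). It is dominated by a fixed Gaussian ([profile_bound]);
    the factor [1 / B yo], which is not bounded, grows at most exponentially
    because [ln B] is Lipschitz. The weight [g] converges to its value at the
    boundary point, which is the first term of the limit ([near_limit]). *)

(** * Measurability of continuous functions on the plane *)

Section plane_measurability.
Context {R : realType}.

Definition rational_box (q : rat * rat * (rat * rat)) : set (R * R) :=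
  `]ratr q.1.1, ratr q.1.2[ `*` `]ratr q.2.1, ratr q.2.2[.

Lemma measurable_rational_box q :
  measurable (rational_box q : set (measurableTypeR R * measurableTypeR R)).
Proof. by apply: measurableX. Qed.

(** The measurable structure of [R * R] is the product sigma-algebra, its topology
    is the product topology; they are related through rational boxes, countably
    many of which exhaust any open set. *)
Lemma open_measurable_plane (O : set (R * R)) :
  open O -> measurable (O : set (measurableTypeR R * measurableTypeR R)).
Proof.
move=> oO.
have -> : O = \bigcup_q
    (if `[< rational_box q `<=` O >] then rational_box q else set0).
  apply/seteqP; split=> [[x y] Oxy|z [q _]]; last first.
    by case: asboolP => // qO /qO.
  move: oO; rewrite openE => /(_ _ Oxy) /nbhs_ballP[e /= e0 eO].
  have rat_near (r : R) : exists q : rat * rat,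
      (ratr q.1 < r < ratr q.2) /\ (r - e < ratr q.1) /\ (ratr q.2 < r + e).
    have /rat_in_itvoo[q1] : r - e < r by rewrite ltrBlDr ltrDl.
    have /rat_in_itvoo[q2] : r < r + e by rewrite ltrDl.
    rewrite !in_itv/= => /andP[h1 h2] /andP[h3 h4].
    by exists (q1, q2); rewrite /= h4 h1.
  have [p [/andP[p1 p2] [p3 p4]]] := rat_near x.
  have [q [/andP[q1 q2] [q3 q4]]] := rat_near y.
  exists (p, q) => //; case: asboolP => [_|]; last first.
    case=> -[x' y'] [] /=; rewrite !in_itv/= => /andP[x1 x2] /andP[y1 y2].
    by apply: eO; split=> /=; rewrite /ball/= ltr_distlC;
      apply/andP; split; lra.
  by split; rewrite /= in_itv/=; apply/andP.
apply: countable_bigcupT_measurable => [|q]; first exact: countableP.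
by case: ifPn => // _; exact: measurable_rational_box.
Qed.

Lemma continuous_measurable_plane (U : set (R * R)) (f : R * R -> R) :
  open U -> (forall z, U z -> {for z, continuous f}) ->
  measurable_fun
    (U : set (measurableTypeR R * measurableTypeR R)) (f : _ -> measurableTypeR R).
Proof.
move=> oU cf; apply: (measurability _ (RGenOpens.measurableE R)).
move=> _ [_ [a [b ->] <-]]; apply: open_measurable_plane.
rewrite openE => z [Uz fz].
have := oU; rewrite openE => /(_ _ Uz) Uz'.
have := cf _ Uz; move=> /(_ `]a, b[%classic) H; apply: filterI => //.
by apply: H; apply: open_nbhs_nbhs; split => //; exact: interval_open.
Qed.

End plane_measurability.

(** * Affine substitution in Lebesgue integrals *)

Section affine_substitution.
Context {R : realType}.
Notation mu := (@lebesgue_measure R).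

Lemma measurable_affine (k d : R) :
  measurable_fun setT
    (fun u : measurableTypeR R => k * u + d : measurableTypeR R).
Proof.
apply: continuous_measurable_fun => x.
by apply: cvgD; [apply: cvgMr; exact: cvg_id|exact: cvg_cst].
Qed.

Variables (k d : R) (k_gt0 : 0 < k).

Let phi (u : measurableTypeR R) : measurableTypeR R := k * u + d.

Let measurable_phi : measurable_fun setT phi := measurable_affine k d.

Let image_measure : {measure set (measurableTypeR R) -> \bar R}.
Proof.
by refine (pushforward mu phi : {measure set _ -> \bar R}); exact: measurable_phi.
Defined.

(** Both measures agree on half-open intervals, hence everywhere. *)
Let lebesgue_affine A : measurable A ->
  mu A = mscale (NngNum (ltW k_gt0)) image_measure A.
Proof.
apply: lebesgue_measure_unique => _ [[a b] _ <-] /=.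
rewrite /mscale/= /pushforward.
have -> : phi @^-1` `]a, b]%classic = `](a - d) / k, (b - d) / k]%classic.
  by apply/seteqP; split=> u; rewrite /= /phi !in_itv/=
    ltr_pdivrMr// ler_pdivlMr// ltrBlDr lerBrDr (mulrC u).
rewrite !lebesgue_measure_itv/= !lte_fin ltr_pM2r ?invr_gt0// ltrD2r.
case: ifPn => _; last by rewrite mule0.
by rewrite -EFinB -EFinM; congr EFin; field; rewrite gt_eqF.
Qed.

Lemma ge0_integral_affine (f : R -> \bar R) :
  measurable_fun setT f -> (forall x, 0 <= f x)%E ->
  (\int[mu]_x f x = k%:E * \int[mu]_x f (k * x + d)%R)%E.
Proof.
move=> mf f0.
rewrite (eq_measure_integral
  (mscale (NngNum (ltW k_gt0)) image_measure)); last first.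
  by move=> A mA _; exact: lebesgue_affine.
rewrite ge0_integral_mscale//=; congr (_ * _)%E.
by rewrite ge0_integral_pushforward.
Qed.

Lemma integrable_affine (f : R -> R) : mu.-integrable setT (EFin \o f) ->
  mu.-integrable setT (EFin \o (fun x => f (k * x + d))).
Proof.
move=> /integrableP[mf fi]; apply/integrableP; split.
  exact: (measurableT_comp mf measurable_phi).
move: fi; rewrite ge0_integral_affine//=.
  move=> h; rewrite ltNge leye_eq; apply/negP => /eqP E.
  by move: h; rewrite E gt0_muley.
exact/measurable_EFinP/measurableT_comp/measurable_EFinP.
Qed.

Lemma Rintegral_affine (f : R -> R) : mu.-integrable setT (EFin \o f) ->
  \int[mu]_x f x = k * \int[mu]_x f (k * x + d).
Proof.
move=> fi; have fi' := integrable_affine fi.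
have mf : measurable_fun setT (EFin \o f) by case/integrableP : fi.
apply: EFin_inj; rewrite EFinM /Rintegral !fineK; last 2 first.
- exact: integrable_fin_num.
- exact: integrable_fin_num.
set f' := EFin \o _ in fi'.
transitivity (k%:E * \int[mu]_x f' x)%E => //.
have decomp := @integralE _ (measurableTypeR R) R mu setT.
rewrite (decomp f') [LHS](decomp (EFin \o f)).
rewrite (ge0_integral_affine (measurable_funepos mf))//.
rewrite (ge0_integral_affine (measurable_funeneg mf))//.
have posE : (\int[mu]_x (EFin \o f)^\+ (k * x + d)%R = \int[mu]_x f'^\+ x)%E.
  by apply: eq_integral => x _; rewrite /f' !funeposE.
have negE : (\int[mu]_x (EFin \o f)^\- (k * x + d)%R = \int[mu]_x f'^\- x)%E.
  by apply: eq_integral => x _; rewrite /f' !funenegE.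
rewrite posE negE -muleBr//.
apply: fin_num_adde_defl.
rewrite fin_numN.
exact: (integrable_neg_fin_num measurableT fi').
Qed.
End affine_substitution.

(** * Dominated convergence for iterated integrals *)

Section iterated_integrals.
Context {R : realType}.
Notation mu := (@lebesgue_measure R).
Notation mu2 := (mu \x mu)%E.

(** Domination by a tensor product of integrable functions makes every section
    integrable, and not only almost every one, so that iterated real integrals
    are integrals over the plane without exceptional sections. *)
Definition tensor_dominated (h H : R -> R) (f : R * R -> R) :=
  forall z, `|f z| <= h z.1 * H z.2.

Variables (h H : R -> R).
Hypotheses (ih : mu.-integrable setT (EFin \o h))
  (iH : mu.-integrable setT (EFin \o H)).

Lemma integrable_tensor :
  mu2.-integrable setT (EFin \o (fun z => h z.1 * H z.2)).
Proof.
have mh : measurable_fun setT h by apply/measurable_EFinP; case/integrableP : ih.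
have mH : measurable_fun setT H by apply/measurable_EFinP; case/integrableP : iH.
apply/integrable12ltyP.
  apply/measurable_EFinP; apply: measurable_funM.
    exact: (measurableT_comp mh measurable_fst).
  exact: (measurableT_comp mH measurable_snd).
have inner x : (\int[mu]_y `|(h x * H y)%:E| = `|h x|%:E * \int[mu]_y `|H y|%:E)%E.
  under eq_integral do rewrite abse_EFin normrM EFinM.
  by rewrite ge0_integralZl//; apply/measurable_EFinP; exact: measurableT_comp.
under eq_integral do rewrite /= inner.
rewrite ge0_integralZr//.
- by apply: lte_mul_pinfty;
    [exact: integral_ge0| |case/integrableP : iH => _ //];
  rewrite ge0_fin_numE; [case/integrableP : ih|exact: integral_ge0].
- by apply/measurable_EFinP; exact: measurableT_comp.
- exact: integral_ge0.
Qed.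

Variables (f : R * R -> R).
Hypotheses (mf : measurable_fun
    (setT : set (measurableTypeR R * measurableTypeR R)) f)
  (fhH : tensor_dominated h H f).

Lemma tensor_dominated_integrable : mu2.-integrable setT (EFin \o f).
Proof.
apply: le_integrable integrable_tensor => //; first exact/measurable_EFinP.
by move=> z _ /=; rewrite lee_fin (le_trans (fhH _))// ler_norm.
Qed.

Lemma tensor_dominated_section x :
  mu.-integrable setT (EFin \o (fun y => f (x, y))).
Proof.
have : mu.-integrable setT (EFin \o (fun y => h x * H y)).
  rewrite (_ : _ \o _ = (fun y => (h x)%:E * (EFin \o H) y)%E).
    exact: integrableZl.
  by apply/funext => y /=; rewrite EFinM.
apply: le_integrable => //.
  by apply/measurable_EFinP; exact: (measurableT_comp mf (pair1_measurable x)).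
by move=> y _ /=; rewrite lee_fin (le_trans (fhH _))// ler_norm.
Qed.

Let sectionE : (EFin \o (fun x => \int[mu]_y f (x, y))) =
  fubini_F mu (EFin \o f).
Proof.
apply/funext => x; rewrite /fubini_F /= /Rintegral fineK//.
exact: (integrable_fin_num measurableT (tensor_dominated_section x)).
Qed.

Lemma integrable_Rintegral_section :
  mu.-integrable setT (EFin \o (fun x => \int[mu]_y f (x, y))).
Proof.
by rewrite sectionE; exact: integrable_fubini_F tensor_dominated_integrable.
Qed.

Lemma iterated_RintegralE :
  \int[mu]_x \int[mu]_y f (x, y) = fine (\int[mu2]_z (f z)%:E)%E.
Proof.
rewrite {1}/Rintegral -(integral12_prod_meas1 tensor_dominated_integrable).
congr fine; apply: eq_integral => x _.
by rewrite -[RHS]/(fubini_F mu (EFin \o f) x) -sectionE.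
Qed.

End iterated_integrals.

Section iterated_dominated_convergence.
Context {R : realType}.
Notation mu := (@lebesgue_measure R).
Notation mu2 := (mu \x mu)%E.

Let vertical_line_null (c : R) : mu2.-negligible ([set c] `*` setT).
Proof.
exists ([set c] `*` setT); split => //.
  by apply: measurableX.
transitivity (mu [set c] * mu setT)%E; first exact: product_measure1E.
by rewrite [X in (X * _)%E](_ : _ = 0%E) ?mul0e//; exact: lebesgue_measure_set1.
Qed.

(** Dominated convergence for the product measure, read through Fubini's theorem.
    A vertical line may be excepted because indicators of time intervals with
    moving endpoints need not converge at the limit of the endpoints. *)
Lemma iterated_dominated_convergence (h H : R -> R) (c : R)
    (f_ : nat -> R * R -> R) (f : R * R -> R) :
  mu.-integrable setT (EFin \o h) -> mu.-integrable setT (EFin \o H) ->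
  (forall n, measurable_fun
     (setT : set (measurableTypeR R * measurableTypeR R)) (f_ n)) ->
  measurable_fun (setT : set (measurableTypeR R * measurableTypeR R)) f ->
  (forall n, tensor_dominated h H (f_ n)) -> tensor_dominated h H f ->
  (forall x y, x != c -> f_ n (x, y) @[n --> \oo] --> f (x, y)) ->
  (\int[mu]_x \int[mu]_y f_ n (x, y)) @[n --> \oo]
    --> \int[mu]_x \int[mu]_y f (x, y).
Proof.
move=> ih iH mf_ mf df_ df cf.
rewrite (iterated_RintegralE ih iH mf df).
under eq_fun do rewrite (iterated_RintegralE ih iH (mf_ _) (df_ _)).
have [||||| if1 _ cI] := @dominated_convergence _ _ _ mu2 _ measurableT
  (fun n => EFin \o f_ n) (EFin \o f) (EFin \o (fun z => h z.1 * H z.2)).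
- by move=> n; exact/measurable_EFinP.
- exact/measurable_EFinP.
- apply: negligibleS (vertical_line_null c) => -[x y]/= xyc; split => //=.
  apply: contrapT => /eqP xc; apply: xyc => _.
  by apply: cvg_EFin; [exact: nearW|exact: cf].
- exact: integrable_tensor.
- by apply/nearW => z n _; rewrite lee_fin df_.
apply: fine_cvg => //.
by rewrite fineK//; exact: (integrable_fin_num measurableT if1).
Qed.

End iterated_dominated_convergence.

(** * Gaussian integrals *)

Section gaussian_integrals.
Context {R : realType}.
Notation mu := (@lebesgue_measure R).

Lemma integrable_gauss_affine (k d : R) : 0 < k ->
  mu.-integrable setT (EFin \o (fun u => expR (- (k * u + d) ^+ 2))).
Proof.
move=> k0; exact: (@integrable_affine R k d k0 (@gauss_fun R) integrableT_gauss).
Qed.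

Lemma Rintegral_gauss_affine (k d : R) : 0 < k ->
  \int[mu]_u expR (- (k * u + d) ^+ 2) = Num.sqrt pi / k.
Proof.
move=> k0; have := @Rintegral_affine R k d k0 (@gauss_fun R) integrableT_gauss.
rewrite /Rintegral integralT_gauss/= => ->.
by rewrite mulrC mulKf ?gt_eqF.
Qed.

Lemma integrable_gaussian (k : R) : 0 < k ->
  mu.-integrable setT (EFin \o (fun u => expR (- (k * u ^+ 2)))).
Proof.
move=> k0; have := @integrable_gauss_affine (Num.sqrt k) 0.
rewrite sqrtr_gt0 => /(_ k0); congr (integrable _ _ (_ \o _)).
by apply/funext => u; rewrite addr0 exprMn sqr_sqrtr// ltW.
Qed.

End gaussian_integrals.

(** * The boundary potential *)

Ltac sign_hyp :=
  match goal with H : _ |- _ => solve [exact: H | apply: ltW; exact: H] end.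

(** Proves [0 <= t] and [0 < t] by following the structure of [t]; the head of
    [t] is matched syntactically, since unification up to conversion would
    unfold real numbers. *)
Ltac sign_step :=
  lazymatch goal with
  | H : ?P |- ?P => exact H
  | |- is_true (@Order.lt _ _ _ ?t) =>
    lazymatch t with
    | @GRing.mul _ _ _ => apply: mulr_gt0
    | @GRing.inv _ _ => rewrite invr_gt0
    | @GRing.exp _ _ _ => apply: exprn_gt0
    | @Algebra.add _ _ _ => apply: addr_gt0
    | @expR _ _ => apply: expR_gt0
    | @pi _ => apply: pi_gt0
    | @Num.Def.sqrtr _ _ => rewrite sqrtr_gt0
    | @Algebra.natmul _ _ _ => rewrite ltr0n; reflexivity
    | _ => sign_hyp
    end
  | |- is_true (@Order.le _ _ _ ?t) =>
    lazymatch t with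
    | @GRing.mul _ _ _ => apply: mulr_ge0
    | @GRing.inv _ _ => rewrite invr_ge0
    | @GRing.exp _ _ 2 => apply: sqr_ge0
    | @GRing.exp _ _ _ => apply: exprn_ge0
    | @Algebra.add _ _ _ => apply: addr_ge0
    | @expR _ _ => apply: expR_ge0
    | @pi _ => apply: pi_ge0
    | @Num.Def.sqrtr _ _ => apply: sqrtr_ge0
    | @Num.norm _ _ _ => apply: normr_ge0
    | @Algebra.natmul _ _ _ => rewrite ler0n; reflexivity
    | _ => sign_hyp
    end
  end.
Ltac sign := solve [repeat sign_step].
(** Discharges the side conditions left by [field]. *)
Ltac nonzero :=
  repeat (apply/andP; split); rewrite ?andbT ?andTb; apply: lt0r_neq0; sign.

Section boundary_potential.
Context {R : realType}.

(** The exponent of the kernel, [6 * X ^+ 2 + 6 * X * Y + 2 * Y ^+ 2], in the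
    variables [X = p - r / 2] and [Y = q + r]: here [r] carries the whole
    dependence on the drift [b2]. *)
Definition qform (p q r : R) : R :=
  6 * p ^+ 2 + 6 * p * q + 2 * q ^+ 2 + q * r + r ^+ 2 / 2.

Lemma qform_ge p q r :
  p ^+ 2 / 8 + q ^+ 2 / 8 - 2 * r ^+ 2 <= qform p q r.
Proof.
(* the difference is a positive combination of these three squares *)
have h1 := sqr_ge0 (47 * p + 24 * q); have h2 := sqr_ge0 (5 * r + q).
by have h3 := sqr_ge0 q; rewrite /qform; lra.
Qed.

Variables a B be : R -> R.

(** The boundary potential at positive times. In terms of the speed
    [a = - b1 (0, .)], a characteristic that enters at the boundary point [yo]
    sits at [x = a yo * s] after the time [s]. *)
Definition potential (s x y yo : R) : R :=
  a yo * Num.sqrt 12 / (2 * pi * B yo * s ^+ 2) *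
  expR (- qform ((x - a yo * s) / (B yo * (s * Num.sqrt s)))
                ((y - yo) / Num.sqrt s) (be yo * Num.sqrt s)).

End boundary_potential.

Section boundary_kernel.
Context {R : realType}.
Variables b1 b2 : R * R -> R.

Lemma powR_3half (s : R) : 0 < s -> s `^ (3 / 2) = s * Num.sqrt s.
Proof.
move=> s0; rewrite (_ : 3 / 2 = 1 + 2^-1); last by field.
rewrite powRD ?powRr1 ?ltW// ?powR12_sqrt ?ltW//.
by rewrite (gt_eqF s0) implybT.
Qed.

Lemma boundary_kernelE (yo s x y : R) : 0 < s -> 0 < pdy b1 (0, yo) ->
  b1 (0, yo) <= 0 ->
  boundary_kernel b1 b2 yo s x y =
  potential (fun z => - b1 (0, z)) (fun z => pdy b1 (0, z))
            (fun z => b2 (0, z)) s x y yo.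
Proof.
move=> s0 B0 b0; rewrite /boundary_kernel /Defs.kernel /kerX /kerY /potential /=.
rewrite ler0_norm// powR_3half// (_ : 1 / 2 = 2^-1) ?mul1r// powR12_sqrt ?ltW//.
have r0 : 0 < Num.sqrt s by rewrite sqrtr_gt0.
set r := Num.sqrt s in r0 *.
rewrite [LHS]mulrA; congr (_ * expR _); first by rewrite mulrA.
congr (- _); rewrite /qform.
rewrite [x - 0]subr0 !mulNr opprK.
by field; nonzero.
Qed.

End boundary_kernel.

Section potential_estimates.
Context {R : realType}.

(** What the proof uses of the coefficients on the axis [x = 0]. The bounds are
    uniform, except that [B] may tend to [0] at infinity: [coef_B_decay], which
    says that [ln B] is Lipschitz, limits its decay to an exponential one.
    [coef_a_mean] is the mean value theorem for [a], whose derivative is [- B]. *)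
Record coefficient_bounds (a B be : R -> R) (b C1 C2 : R) : Prop := {
  coef_b_gt0 : 0 < b;
  coef_C1_gt0 : 0 < C1;
  coef_C2_gt0 : 0 < C2;
  coef_a_cont : continuous a;
  coef_B_cont : continuous B;
  coef_be_cont : continuous be;
  coef_a_ge : forall y, b <= a y;
  coef_a_le : forall y, a y <= C1;
  coef_B_gt0 : forall y, 0 < B y;
  coef_B_le : forall y, B y <= C1;
  coef_be_le : forall y, `|be y| <= C1;
  coef_B_decay : forall y z, B y * expR (- (C2 * `|z - y|)) <= B z;
  coef_a_mean : forall y z, exists2 xi,
    `|xi - y| <= `|z - y| & a z - a y = - B xi * (z - y)
}.

Variables (a B be : R -> R) (b C1 C2 : R).
Hypothesis cb : coefficient_bounds a B be b C1 C2.

Let b_gt0 := coef_b_gt0 cb.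
Let C1_gt0 := coef_C1_gt0 cb.
Let C2_gt0 := coef_C2_gt0 cb.
Let a_ge := coef_a_ge cb.
Let a_le := coef_a_le cb.
Let B_gt0 := coef_B_gt0 cb.
Let B_le := coef_B_le cb.
Let a_gt0 y : 0 < a y. Proof. exact: lt_le_trans (a_ge y). Qed.

Notation K := (potential a B be).

Lemma potential_ge0 (s x y yo : R) : 0 <= K s x y yo.
Proof.
by rewrite /potential; sign.
Qed.

Let sqrtC : R := Num.sqrt 12 / (2 * pi).
Let sqrtC_ge0 : 0 <= sqrtC.
Proof. by rewrite /sqrtC; sign. Qed.

(** The drift term contributes at most a bounded factor, uniformly in bounded
    time. *)
Lemma potential_le_gauss (T s x y yo : R) : 0 < s < T ->
  K s x y yo <= C1 * sqrtC * expR (2 * C1 ^+ 2 * T) / (B yo * s ^+ 2) *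
    expR (- (((x - a yo * s) / (B yo * (s * Num.sqrt s))) ^+ 2 / 8)) *
    expR (- ((yo - y) ^+ 2 / (8 * T))).
Proof.
move=> /andP[s0 sT]; rewrite /potential.
set p := (x - _) / _; set q := (y - yo) / _; set r := be yo * _.
have rT : r ^+ 2 <= C1 ^+ 2 * T.
  rewrite exprMn sqr_sqrtr; last exact: ltW.
  apply: ler_pM; [exact: sqr_ge0|exact: ltW| |exact: ltW].
  rewrite -(real_normK (num_real (be yo))) lerXn2r ?nnegrE//; first exact: ltW.
  exact: coef_be_le cb yo.
have qT : (yo - y) ^+ 2 / (8 * T) <= q ^+ 2 / 8.
  have T0 : 0 < T := lt_trans s0 sT.
  have -> : q ^+ 2 / 8 = (yo - y) ^+ 2 / 8 / s.
    by rewrite /q exprMn exprVn sqr_sqrtr; [field; nonzero|exact: ltW].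
  rewrite invfM mulrA ler_wpM2l//; first by sign.
  by rewrite lef_pV2 ?posrE// ltW.
have -> : a yo * Num.sqrt 12 / (2 * pi * B yo * s ^+ 2) =
    a yo * sqrtC / (B yo * s ^+ 2).
  by rewrite /sqrtC; move: (@pi R) (pi_gt0 R) => P P0; field; nonzero.
have -> : C1 * sqrtC * expR (2 * C1 ^+ 2 * T) / (B yo * s ^+ 2) *
    expR (- (p ^+ 2 / 8)) * expR (- ((yo - y) ^+ 2 / (8 * T))) =
    C1 * sqrtC / (B yo * s ^+ 2) * expR (2 * C1 ^+ 2 * T +
       - (p ^+ 2 / 8) + - ((yo - y) ^+ 2 / (8 * T))).
  by rewrite !expRD; ring.
apply: ler_pM; [by sign|by sign| |].
- rewrite ler_wpM2r; [by []|by sign|].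
  by rewrite ler_wpM2r.
- by rewrite ler_expR; have := qform_ge p q r; lra.
Qed.

End potential_estimates.

(** * Gaussian bounds on the potential *)

Section potential_bounds.
Context {R : realType}.
Variables (a B be : R -> R) (b C1 C2 : R).
Hypothesis cb : coefficient_bounds a B be b C1 C2.

Let b_gt0 := coef_b_gt0 cb.
Let C1_gt0 := coef_C1_gt0 cb.
Let C2_gt0 := coef_C2_gt0 cb.
Let a_ge := coef_a_ge cb.
Let a_le := coef_a_le cb.
Let B_gt0 := coef_B_gt0 cb.
Let B_le := coef_B_le cb.
Let a_gt0 y : 0 < a y. Proof. exact: lt_le_trans (a_ge y). Qed.

Notation K := (potential a B be).
Notation kappa := (Num.sqrt 12 / (2 * pi) : R).

Let kappa_ge0 : 0 <= kappa.
Proof. by sign. Qed.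

Lemma expRN_le_inv_sqr (m : R) : 0 < m -> expR (- m) <= 2 / m ^+ 2.
Proof.
move=> m0; rewrite expRN -[2 / _]invf_div.
rewrite lef_pV2 ?posrE ?expR_gt0 ?divr_gt0 ?exprn_gt0//.
have := expR_ge1Dxn 1 (ltW m0); rewrite (_ : 2`!%N = 2%N)//.
by apply: le_trans; rewrite lerDr.
Qed.

Lemma linear_le_sqr (k c w : R) :
  0 < k -> c * `|w| <= k * w ^+ 2 + c ^+ 2 / (4 * k).
Proof.
move=> k0; rewrite -subr_ge0 -(real_normK (num_real w)).
have -> : k * `|w| ^+ 2 + c ^+ 2 / (4 * k) - c * `|w| =
    (2 * k * `|w| - c) ^+ 2 / (4 * k) by field; nonzero.
by rewrite divr_ge0 ?sqr_ge0// mulr_ge0// ltW.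
Qed.

Definition far_const (T : R) :=
  C1 * kappa * expR (2 * C1 ^+ 2 * T) * (2 * 32 ^+ 2 * C1 ^+ 3 / b ^+ 4).

(** Away from the characteristic [x = a s] the exponent is at least of order
    [1 / (B ^+ 2 * s)]; this beats both the singularity in time and the
    degeneracy of [B], which has no positive lower bound. *)
Lemma potential_far (T s x y yo : R) : 0 < s < T ->
  b / 2 * s <= `|x - a yo * s| ->
  K s x y yo <= far_const T * expR (- ((yo - y) ^+ 2 / (8 * T))).
Proof.
move=> sT far; have /andP[s0 _] := sT.
apply: le_trans (potential_le_gauss cb x y yo sT) _.
rewrite ler_wpM2r ?expR_ge0//.
set p := (x - _) / _.
have B0 := B_gt0 yo.
pose m := b ^+ 2 / (32 * B yo ^+ 2 * s).
have m0 : 0 < m by rewrite /m; sign.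
have mp : m <= p ^+ 2 / 8.
  rewrite /p exprMn exprVn !exprMn sqr_sqrtr; last exact: ltW.
  rewrite -(real_normK (num_real (x - _))).
  have -> : m = (b / 2 * s) ^+ 2 / (B yo ^+ 2 * (s ^+ 2 * s)) / 8.
    by rewrite /m; move: kappa => kp; field; nonzero.
  rewrite ler_pM2r ?invr_gt0// ler_pM2r; last first.
    by sign.
  by rewrite lerXn2r ?nnegrE// ltW// mulr_gt0// divr_gt0.
have E : expR (- (p ^+ 2 / 8)) <= 2 / m ^+ 2.
  by apply: le_trans (expRN_le_inv_sqr m0); rewrite ler_expR lerN2.
apply: le_trans (ler_wpM2l _ E) _.
  by sign.
have -> : C1 * kappa * expR (2 * C1 ^+ 2 * T) / (B yo * s ^+ 2) * (2 / m ^+ 2) =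
    C1 * kappa * expR (2 * C1 ^+ 2 * T) * (2 * 32 ^+ 2 * B yo ^+ 3 / b ^+ 4).
  by rewrite /m; move: kappa => kp; field; nonzero.
rewrite /far_const ler_wpM2l//; first by sign.
rewrite ler_pM2r ?invr_gt0 ?exprn_gt0// ler_pM2l//.
by rewrite lerXn2r ?nnegrE ?B_le// ltW.
Qed.

Lemma B_inv_le (y z : R) : (B z)^-1 <= expR (C2 * `|z - y|) / B y.
Proof.
have := coef_B_decay cb y z; rewrite expRN => h.
rewrite -[leRHS]invf_div lef_pV2 ?posrE ?divr_gt0 ?expR_gt0//.
Qed.

Definition late_const (T y s0 : R) :=
  C1 * kappa * expR (2 * C1 ^+ 2 * T) / (B y * s0 ^+ 2) * expR (4 * T * C2 ^+ 2).

(** At times bounded below, only [1 / B yo] can be large; it grows at most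
    exponentially and is absorbed by half of the Gaussian. *)
Lemma potential_late (T s0 s x y yo : R) : 0 < s0 -> s0 <= s -> s < T ->
  K s x y yo <= late_const T y s0 * expR (- ((yo - y) ^+ 2 / (16 * T))).
Proof.
move=> s00 s0s sT; have s_gt0 : 0 < s := lt_le_trans s00 s0s.
have T0 : 0 < T := lt_trans s_gt0 sT.
apply: le_trans (@potential_le_gauss _ _ _ _ _ _ _ cb T s x y yo _) _.
  by rewrite s_gt0.
set p := (x - _) / _.
pose c := C1 * kappa * expR (2 * C1 ^+ 2 * T) / s0 ^+ 2.
have c0 : 0 <= c.
  by rewrite /c; sign.
apply: (@le_trans _ _ (c * (expR (C2 * `|yo - y|) / B y) * 1 *
    expR (- ((yo - y) ^+ 2 / (8 * T))))).
  rewrite ler_wpM2r ?expR_ge0//; apply: ler_pM; [by sign|by sign| |].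
    rewrite /c [leRHS]mulrAC (invfM (B yo)) [leLHS]mulrA.
    apply: ler_pM; [by sign|by sign| |].
      by rewrite ler_wpM2l ?B_inv_le//; sign.
    by rewrite lef_pV2 ?posrE ?exprn_gt0// lerXn2r ?nnegrE// ltW.
  by rewrite -expR0 ler_expR oppr_le0 divr_ge0 ?sqr_ge0.
rewrite mulr1.
have -> : late_const T y s0 * expR (- ((yo - y) ^+ 2 / (16 * T))) =
    c * (expR (4 * T * C2 ^+ 2 + - ((yo - y) ^+ 2 / (16 * T))) / B y).
  by rewrite expRD /late_const /c; move: kappa => kp; field; nonzero.
rewrite -mulrA ler_wpM2l// mulrAC -expRD; apply: ler_wpM2r; first by sign.
rewrite ler_expR.
have kT : 0 < (16 * T)^-1 by rewrite invr_gt0 mulr_gt0.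
have := linear_le_sqr C2 (yo - y) kT.
have -> : C2 ^+ 2 / (4 / (16 * T)) = 4 * T * C2 ^+ 2 by field; nonzero.
have -> : (yo - y) ^+ 2 / (8 * T) = 2 * ((16 * T)^-1 * (yo - y) ^+ 2).
  by field; nonzero.
by rewrite [_ / (16 * T)]mulrC; lra.
Qed.

End potential_bounds.

(** * The potential rescaled around the characteristic *)

Section rescaled_potential.
Context {R : realType}.
Variables (a B be : R -> R) (b C1 C2 : R).
Hypothesis cb : coefficient_bounds a B be b C1 C2.

Let b_gt0 := coef_b_gt0 cb.
Let C1_gt0 := coef_C1_gt0 cb.
Let C2_gt0 := coef_C2_gt0 cb.
Let a_ge := coef_a_ge cb.
Let a_le := coef_a_le cb.
Let B_gt0 := coef_B_gt0 cb.
Let B_le := coef_B_le cb.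
Let a_gt0 y : 0 < a y. Proof. exact: lt_le_trans (a_ge y). Qed.

Notation K := (potential a B be).
Notation kappa := (Num.sqrt 12 / (2 * pi) : R).

(** The potential, multiplied by the Jacobian of the substitution
    [s = x * sg], [yo = y + Num.sqrt x * v], where
    [sg = (1 + Num.sqrt x * u) / a y]: the mass of the potential sits at times
    [s = x / a + O (x `^ (3 / 2))] and at points [yo = y + O (x `^ (1 / 2))]. The
    parameters [al], [B0], [B1], [r] stand for the ratio of the speeds at [yo]
    and [y], for [B] at [yo] and at an intermediate point, and for the drift. *)
Definition profile (al B0 B1 r sg u v : R) : R :=
  al * kappa / (B0 * sg ^+ 2) *
  expR (- qform ((- u + B1 * v * sg) / (B0 * (sg * Num.sqrt sg)))
                (- v / Num.sqrt sg) r).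

(** The numerator [x - a yo * s] is of order [x `^ (3 / 2)] because [a yo - a y] is
    of order [x `^ (1 / 2)], by the mean value theorem; so no power of [x] is left
    once the Jacobian is taken into account. *)
Lemma potential_rescaled (w y u v xi : R) :
  let sg := (1 + w * u) / a y in
  0 < w -> 0 < sg -> a (y + w * v) - a y = - B xi * (w * v) ->
  w ^+ 4 / a y * K (w ^+ 2 * sg) (w ^+ 2) y (y + w * v) =
  profile (a (y + w * v) / a y) (B (y + w * v)) (B xi)
    (be (y + w * v) * (w * Num.sqrt sg)) sg u v.
Proof.
move=> sg w0 sg0 mean; rewrite /potential /profile.
have -> : Num.sqrt (w ^+ 2 * sg) = w * Num.sqrt sg.
  by rewrite sqrtrM ?sqr_ge0// sqrtr_sqr gtr0_norm.
have r0 : 0 < Num.sqrt sg by rewrite sqrtr_gt0.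
set r := Num.sqrt sg in r0 *.
have ay0 := a_gt0 y; have Bo0 := B_gt0 (y + w * v).
(* the first order terms in [a y * sg = 1 + w * u] cancel *)
have num : w ^+ 2 - a (y + w * v) * (w ^+ 2 * sg) =
    w ^+ 3 * (- u + B xi * v * sg).
  have -> : a (y + w * v) = a y - B xi * (w * v) by rewrite -mulNr -mean; ring.
  have -> : w ^+ 2 - (a y - B xi * (w * v)) * (w ^+ 2 * sg) =
    w ^+ 2 * (1 - a y * sg) + w ^+ 3 * (B xi * v * sg) by ring.
  by rewrite /sg mulrCA divff ?gt_eqF//; ring.
rewrite num [LHS]mulrA; congr (_ * expR (- qform _ _ _)).
- by move: (Num.sqrt 12) (@pi R) (pi_gt0 R) => t P P0; field; nonzero.
- by field; nonzero.
- by field; nonzero.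
Qed.

Definition rescaled_rate (M : R) := (16 * (2 * C1 ^+ 2 * M ^+ 3 + M))^-1.

Definition rescaled_const (T M B0 : R) :=
  C1 / b * kappa / B0 * M ^+ 2 *
  expR (2 * C1 ^+ 2 * T + C2 ^+ 2 / (4 * rescaled_rate M)).

(** For [sg] in a compact interval the variables [(u, v)] are linear in [(p, q)]
    with bounded coefficients, so the exponent is coercive in [(u, v)]; half of the
    resulting Gaussian pays for the growth of [1 / B yo]. *)
Lemma profile_bound (T M B0 w y u v xi r sg : R) :
  0 < T -> 0 < M -> 0 < B0 -> B0 <= B y -> 0 < w <= 1 ->
  M^-1 <= sg <= M -> r ^+ 2 <= C1 ^+ 2 * T ->
  profile (a (y + w * v) / a y) (B (y + w * v)) (B xi) r sg u v <=
  rescaled_const T M B0 *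
    (expR (- (rescaled_rate M * u ^+ 2)) * expR (- (rescaled_rate M * v ^+ 2))).
Proof.
move=> T0 M0 B00 B0y /andP[w0 w1] /andP[Msg sgM] rT.
have sg0 : 0 < sg by apply: lt_le_trans Msg; rewrite invr_gt0.
have q0 : 0 < Num.sqrt sg by rewrite sqrtr_gt0.
set yo := y + w * v; rewrite /profile.
set p := (- u + _) / _; set q := - v / _.
have L0 : 0 < 2 * C1 ^+ 2 * M ^+ 3 + M by sign.
have k0 : 0 < rescaled_rate M by rewrite /rescaled_rate; sign.
have Byo := B_gt0 yo; have Bxi := B_gt0 xi.
have sq_le (z t : R) : 0 < z -> z <= t -> z ^+ 2 <= t ^+ 2.
  by move=> z0 zt; rewrite lerXn2r ?nnegrE// ltW// (lt_le_trans z0).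
have sgE : Num.sqrt sg ^+ 2 = sg by rewrite sqr_sqrtr// ltW.
have v2 : v ^+ 2 = sg * q ^+ 2.
  by rewrite -{1}sgE /q; field; nonzero.
have v2le : v ^+ 2 <= M * q ^+ 2 by rewrite v2 ler_wpM2r// sqr_ge0.
have u2le : u ^+ 2 <= 2 * C1 ^+ 2 * M ^+ 3 * (p ^+ 2 + q ^+ 2).
  have uE : u = B xi * v * sg - B yo * (sg * Num.sqrt sg) * p.
    by rewrite /p; field; nonzero.
  have h1 : (B xi * v * sg) ^+ 2 <= C1 ^+ 2 * M ^+ 3 * q ^+ 2.
    have -> : (B xi * v * sg) ^+ 2 = B xi ^+ 2 * sg ^+ 2 * v ^+ 2 by ring.
    have -> : C1 ^+ 2 * M ^+ 3 * q ^+ 2 = C1 ^+ 2 * M ^+ 2 * (M * q ^+ 2) by ring.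
    apply: ler_pM => //; [by sign|by sign|].
    by apply: ler_pM; [by sign|by sign|exact: sq_le|exact: sq_le].
  have h2 : (B yo * (sg * Num.sqrt sg) * p) ^+ 2 <= C1 ^+ 2 * M ^+ 3 * p ^+ 2.
    rewrite !exprMn sgE; apply: ler_wpM2r; first by sign.
    apply: ler_pM; [by sign|by sign|exact: sq_le|].
    have -> : M ^+ 3 = M ^+ 2 * M by ring.
    by apply: ler_pM; [by sign|by sign|exact: sq_le|].
  have := sqr_ge0 (B xi * v * sg + B yo * (sg * Num.sqrt sg) * p).
  by rewrite {1}uE; move: h1 h2; set A := B xi * v * sg;
    set D := B yo * (sg * _) * p; lra.
have uv : 2 * rescaled_rate M * (u ^+ 2 + v ^+ 2) <= p ^+ 2 / 8 + q ^+ 2 / 8.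
  have -> : 2 * rescaled_rate M = (8 * (2 * C1 ^+ 2 * M ^+ 3 + M))^-1.
    by rewrite /rescaled_rate; field; nonzero.
  rewrite mulrC ler_pdivrMr; last by sign.
  have p2 : 0 <= M * p ^+ 2 by sign.
  by move: u2le v2le p2; set Q := 2 * C1 ^+ 2 * M ^+ 3; lra.
have E : - qform p q r + C2 * `|v| <=
    2 * C1 ^+ 2 * T + C2 ^+ 2 / (4 * rescaled_rate M)
    + - (rescaled_rate M * u ^+ 2) + - (rescaled_rate M * v ^+ 2).
  have := linear_le_sqr C2 v k0; have := qform_ge p q r.
  have ku : 0 <= rescaled_rate M * u ^+ 2 by sign.
  by move: uv rT ku; lra.
have al : a yo / a y <= C1 / b.
  apply: ler_pM; [by sign|by sign|exact: a_le|].
  by rewrite lef_pV2 ?posrE.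
have sgV : (sg ^+ 2)^-1 <= M ^+ 2.
  rewrite -[leRHS]invrK lef_pV2 ?posrE; [|by sign|by sign].
  by rewrite -exprVn; apply: sq_le => //; sign.
have BV : (B yo)^-1 <= expR (C2 * `|v|) / B0.
  apply: le_trans (B_inv_le cb y yo) _.
  apply: ler_pM; [by sign|by sign| |by rewrite lef_pV2 ?posrE].
  rewrite ler_expR ler_pM2l// /yo addrAC subrr add0r normrM gtr0_norm//.
  by rewrite ler_piMl.
apply: (@le_trans _ _ (C1 / b * kappa * ((expR (C2 * `|v|) / B0) * M ^+ 2) *
    expR (- qform p q r))).
  apply: ler_wpM2r; first by sign.
  apply: ler_pM; [by sign|by sign| |].
    by apply: ler_wpM2r al; sign.
  by rewrite invfM; apply: ler_pM => //; sign.
have -> : rescaled_const T M B0 * (expR (- (rescaled_rate M * u ^+ 2)) *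
    expR (- (rescaled_rate M * v ^+ 2))) =
    C1 / b * kappa / B0 * M ^+ 2 *
    expR (2 * C1 ^+ 2 * T + C2 ^+ 2 / (4 * rescaled_rate M)
    + - (rescaled_rate M * u ^+ 2) + - (rescaled_rate M * v ^+ 2)).
  by rewrite /rescaled_const !(expRD _ (- (_ * _))); ring.
have -> : C1 / b * kappa * (expR (C2 * `|v|) / B0 * M ^+ 2) * expR (- qform p q r)
    = C1 / b * kappa / B0 * M ^+ 2 * expR (- qform p q r + C2 * `|v|).
  by rewrite expRD; ring.
by rewrite ler_wpM2l ?ler_expR//; sign.
Qed.

End rescaled_potential.

(** * Continuity of the potential and of its profile *)

Section continuity.
Context {R : realType}.
Variables (I : Type) (F : set_system I).
Hypothesis FF : Filter F.

Lemma cvg_qform (p_ q_ r_ : I -> R) (p q r : R) :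
  p_ @ F --> p -> q_ @ F --> q -> r_ @ F --> r ->
  (fun i => qform (p_ i) (q_ i) (r_ i)) @ F --> qform p q r.
Proof.
move=> cp cq cr; rewrite /qform.
by repeat first [assumption | exact: cvg_cst | apply: cvgD | apply: cvgM].
Qed.

Lemma cvg_potential (a B be : R -> R) (s_ x_ y_ o_ : I -> R) (s x y o : R) :
  continuous a -> continuous B -> continuous be -> (forall z, 0 < B z) -> 0 < s ->
  s_ @ F --> s -> x_ @ F --> x -> y_ @ F --> y -> o_ @ F --> o ->
  (fun i => potential a B be (s_ i) (x_ i) (y_ i) (o_ i)) @ F
    --> potential a B be s x y o.
Proof.
move=> ca cB cbe B0 s0 cs cx cy co; rewrite /potential.
have cao : a (o_ i) @[i --> F] --> a o by exact: (continuous_cvg _ (ca o)).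
have cBo : B (o_ i) @[i --> F] --> B o by exact: (continuous_cvg _ (cB o)).
have cbo : be (o_ i) @[i --> F] --> be o by exact: (continuous_cvg _ (cbe o)).
have cr : Num.sqrt (s_ i) @[i --> F] --> Num.sqrt s.
  by apply: continuous_cvg cs; exact: sqrt_continuous.
have r0 : 0 < Num.sqrt s by rewrite sqrtr_gt0.
have pi0 := pi_gt0 R; have Bo0 := B0 o.
apply: cvgM.
  apply: cvgM; first by apply: cvgM => //; exact: cvg_cst.
  apply: cvgV; first by nonzero.
  by repeat first [assumption | exact: cvg_cst | apply: cvgM].
apply: continuous_cvg; first exact: continuous_expR.
apply: cvgN; apply: cvg_qform.
- apply: cvgM; first by repeat first [assumption | apply: cvgB | apply: cvgM].
  apply: cvgV; first by nonzero.
  by repeat first [assumption | apply: cvgM].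
- by apply: cvgM; [exact: cvgB|apply: cvgV => //; nonzero].
- exact: cvgM.
Qed.

Lemma cvg_profile (al_ B0_ B1_ r_ sg_ : I -> R) (al B0 B1 r sg u v : R) :
  0 < B0 -> 0 < sg ->
  al_ @ F --> al -> B0_ @ F --> B0 -> B1_ @ F --> B1 -> r_ @ F --> r ->
  sg_ @ F --> sg ->
  (fun i => profile (al_ i) (B0_ i) (B1_ i) (r_ i) (sg_ i) u v) @ F
    --> profile al B0 B1 r sg u v.
Proof.
move=> B0_gt0 sg0 cal cB0 cB1 cr csg; rewrite /profile.
have cq : Num.sqrt (sg_ i) @[i --> F] --> Num.sqrt sg.
  by apply: continuous_cvg csg; exact: sqrt_continuous.
have q0 : 0 < Num.sqrt sg by rewrite sqrtr_gt0.
apply: cvgM.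
  apply: cvgM; first by apply: cvgM => //; exact: cvg_cst.
  apply: cvgV; first by nonzero.
  by repeat first [assumption | exact: cvg_cst | apply: cvgM].
apply: continuous_cvg; first exact: continuous_expR.
apply: cvgN; apply: cvg_qform => //.
- apply: cvgM.
    by repeat first [assumption | exact: cvg_cst | apply: cvgD | apply: cvgM].
  apply: cvgV; first by nonzero.
  by repeat first [assumption | apply: cvgM].
- by apply: cvgM; [exact: cvg_cst|apply: cvgV => //; nonzero].
Qed.

End continuity.

(** * Restriction to a set of times *)

Section time_restriction.
Context {R : realType}.
Notation mu := (@lebesgue_measure R).

Definition cut (D : set R) (F : R -> R -> R) (z : R * R) : R :=
  \1_D z.1 * F z.1 z.2.

Lemma measurable_cut (D : set R) (F : R -> R -> R) : measurable D ->
  D `<=` [set s | 0 < s] ->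
  (forall z : R * R, 0 < z.1 -> {for z, continuous (fun z => F z.1 z.2)}) ->
  measurable_fun (setT : set (measurableTypeR R * measurableTypeR R)) (cut D F).
Proof.
move=> mD Dpos cF.
pose U : set (R * R) := [set z | 0 < z.1].
have oU : open U.
  by apply: (@open_comp _ _ fst [set s : R | 0 < s]);
    [move=> z _; exact: cvg_fst|exact: open_gt].
have mF := continuous_measurable_plane oU cF.
pose E : set (measurableTypeR R * measurableTypeR R) := D `*` setT.
have mE : measurable E by exact: measurableX.
have mEF : measurable_fun E (fun z => F z.1 z.2).
  apply: measurable_funS mF; first exact: open_measurable_plane.
  by move=> z [/= /Dpos].
have := (measurable_restrictT _ mE).1 mEF; apply: eq_measurable_fun => z _.
rewrite patchE /cut indicE /E in_setX/= in_setT andbT.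
by case: ifPn => _; rewrite ?mul1r ?mul0r.
Qed.

Variables (D : set R) (F : R -> R -> R) (h H : R -> R).
Hypotheses (mD : measurable D)
  (ih : mu.-integrable setT (EFin \o h)) (iH : mu.-integrable setT (EFin \o H))
  (mF : measurable_fun
     (setT : set (measurableTypeR R * measurableTypeR R)) (cut D F))
  (dF : tensor_dominated h H (cut D F)).

Lemma cut_section_integrable s : D s -> mu.-integrable setT (EFin \o F s).
Proof.
move=> Ds; have := tensor_dominated_section iH mF dF s.
congr (integrable _ _ (_ \o _)); apply/funext => y.
by rewrite /cut indicE mem_set// mul1r.
Qed.

Let cutE : (fun s => \int[mu]_y F s y) \_ D =
  (fun s => \int[mu]_y cut D F (s, y)).
Proof.
apply/funext => s; rewrite patchE; case: ifPn => sD.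
  by apply: eq_Rintegral => y _; rewrite /cut indicE sD mul1r.
rewrite -[LHS](_ : \int[mu]_y 0 = 0); last first.
  by rewrite /Rintegral integral0.
by apply: eq_Rintegral => y _; rewrite /cut indicE (negbTE sD) mul0r.
Qed.

Lemma cut_integrable :
  mu.-integrable D (EFin \o (fun s => \int[mu]_y F s y)).
Proof.
have E : (EFin \o (fun s => \int[mu]_y F s y)) \_ D =
    EFin \o ((fun s => \int[mu]_y F s y) \_ D).
  by apply/funext => s; rewrite /= !patchE; case: ifP.
have := (@integrable_mkcond _ _ _ mu D
  (EFin \o (fun s => \int[mu]_y F s y)) mD).2; apply; rewrite E.
rewrite cutE. 
by have := integrable_Rintegral_section ih iH mF dF.
Qed.

Lemma Rintegral_cut :
  \int[mu]_(s in D) \int[mu]_y F s y = \int[mu]_s \int[mu]_y cut D F (s, y).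
Proof. by rewrite Rintegral_mkcond cutE. Qed.

End time_restriction.

Section iterated_affine_substitution.
Context {R : realType}.
Notation mu := (@lebesgue_measure R).

Lemma iterated_Rintegral_affine (h H : R -> R) (f : R * R -> R)
    (k1 d1 k2 d2 : R) : 0 < k1 -> 0 < k2 ->
  mu.-integrable setT (EFin \o h) -> mu.-integrable setT (EFin \o H) ->
  measurable_fun (setT : set (measurableTypeR R * measurableTypeR R)) f ->
  tensor_dominated h H f ->
  \int[mu]_s \int[mu]_y f (s, y) =
  \int[mu]_u \int[mu]_v (k1 * k2 * f (k1 * u + d1, k2 * v + d2)).
Proof.
move=> k10 k20 ih iH mf df.
have iJ := integrable_Rintegral_section ih iH mf df.
rewrite (Rintegral_affine d1 k10 iJ) -RintegralZl//; last first.
  exact: (integrable_affine d1 k10 iJ).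
apply: eq_Rintegral => u _.
have is_ := tensor_dominated_section iH mf df (k1 * u + d1).
have is' := integrable_affine d2 k20 is_.
by rewrite (Rintegral_affine d2 k20 is_) mulrA -RintegralZl.
Qed.

End iterated_affine_substitution.

(** * The total mass of the limit profile *)

Section limit_profile.
Context {R : realType}.
Notation mu := (@lebesgue_measure R).
Variables (al B0 : R) (al_gt0 : 0 < al) (B0_gt0 : 0 < B0).

(** At the characteristic the rescaled potential is a probability density:
    integrating over the space variable first leaves a centred Gaussian in the
    time variable. *)
Lemma Rintegral_profile (g : R) :
  \int[mu]_u \int[mu]_v (profile 1 B0 B0 0 al^-1 u v * g) = g.
Proof.
pose ra := Num.sqrt al; have ra0 : 0 < ra by rewrite sqrtr_gt0.
have raE : al = ra ^+ 2 by rewrite sqr_sqrtr// ltW.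
have rV : Num.sqrt al^-1 = ra^-1 by rewrite sqrtrV// ltW.
pose s2 : R := Num.sqrt 2; have s20 : 0 < s2 by rewrite sqrtr_gt0.
pose s3 : R := Num.sqrt 3; have s30 : 0 < s3 by rewrite sqrtr_gt0.
have s2E : s2 ^+ 2 = 2 by rewrite sqr_sqrtr.
have s3E : s3 ^+ 2 = 3 by rewrite sqr_sqrtr.
have s12 : Num.sqrt 12 = 2 * s3 :> R.
  rewrite (_ : 12 = 2 ^+ 2 * 3 :> R); last by ring.
  by rewrite sqrtrM// sqrtr_sqr gtr0_norm.
pose P0 := ra ^+ 3 / B0; have P00 : 0 < P0 by rewrite /P0; sign.
pose c := Num.sqrt 12 / (2 * pi) / (B0 * al^-1 ^+ 2).
pose k2 := s2 * ra; have k20 : 0 < k2 by rewrite /k2; sign.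
pose k1 := s3 / s2 * P0; have k10 : 0 < k1 by rewrite /k1; sign.
pose d u := - (3 / s2 * P0 * u).
(* completing the square in [v]: the sum of the squares is the exponent, with
   [P0 * u] the value of [- p] at [v = 0] *)
have densE u v : profile 1 B0 B0 0 al^-1 u v =
    c * expR (- (k1 * u + 0) ^+ 2) * expR (- (k2 * v + d u) ^+ 2).
  have s2V : s2^-1 = s2 / 2 by rewrite -s2E; field; nonzero.
  have E1 : (k1 * u + 0) ^+ 2 = 3 / 2 * (P0 * u) ^+ 2.
    have -> : (k1 * u + 0) ^+ 2 = s3 ^+ 2 / s2 ^+ 2 * (P0 * u) ^+ 2.
      by rewrite /k1; move: (P0) => Q; field; nonzero.
    by rewrite s3E s2E.
  have E2 : (k2 * v + d u) ^+ 2 = 2 * (ra * v - 3 / 2 * (P0 * u)) ^+ 2.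
    have -> : k2 * v + d u = s2 * (ra * v - 3 / 2 * (P0 * u)).
      by rewrite /k2 /d s2V; ring.
    by rewrite exprMn s2E.
  rewrite -[RHS]mulrA -expRD E1 E2 /profile rV mul1r; congr (_ * expR _).
  by rewrite /qform /P0 raE; field; nonzero.
have inner u : \int[mu]_v (profile 1 B0 B0 0 al^-1 u v * g) =
    g * c * (Num.sqrt pi / k2) * expR (- (k1 * u + 0) ^+ 2).
  under eq_Rintegral do rewrite densE mulrC mulrA.
  rewrite RintegralZl//; last exact: integrable_gauss_affine.
  by rewrite Rintegral_gauss_affine//; ring.
under eq_Rintegral do rewrite inner.
rewrite RintegralZl//; last exact: integrable_gauss_affine.
rewrite Rintegral_gauss_affine// /c s12 /k1 /k2 /P0 raE.
have pE : Num.sqrt pi * Num.sqrt pi = pi :> R.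
  by rewrite -expr2 sqr_sqrtr// pi_ge0.
have p0 : 0 < Num.sqrt pi :> R by rewrite sqrtr_gt0 pi_gt0.
rewrite -{1}pE; move: (Num.sqrt pi) p0 => P p0.
by field; nonzero.
Qed.

End limit_profile.

(** * Domination of the weighted potential *)

Section weighted_potential.
Context {R : realType}.
Notation mu := (@lebesgue_measure R).
Variables (a B be : R -> R) (b C1 C2 T : R) (G : R * R * R * R -> R) (CG : R).
Hypotheses (cb : coefficient_bounds a B be b C1 C2) (T_gt0 : 0 < T)
  (cG : continuous G) (CG_gt0 : 0 < CG) (bG : forall z, `|G z| <= CG).

Let b_gt0 := coef_b_gt0 cb.
Let C1_gt0 := coef_C1_gt0 cb.
Let C2_gt0 := coef_C2_gt0 cb.
Let a_ge := coef_a_ge cb.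
Let a_le := coef_a_le cb.
Let B_gt0 := coef_B_gt0 cb.
Let B_le := coef_B_le cb.
Let a_gt0 y : 0 < a y. Proof. exact: lt_le_trans (a_ge y). Qed.

Notation K := (potential a B be).

Definition weighted (x y s yo : R) : R := K s x y yo * G (s, x, y, yo).

Lemma cvg_weighted (I : Type) (F : set_system I) (FF : Filter F)
    (s_ x_ y_ o_ : I -> R) (s x y o : R) : 0 < s ->
  s_ @ F --> s -> x_ @ F --> x -> y_ @ F --> y -> o_ @ F --> o ->
  (fun i => weighted (x_ i) (y_ i) (s_ i) (o_ i)) @ F --> weighted x y s o.
Proof.
move=> s0 cs cx cy co; apply: cvgM.
  apply: cvg_potential => //.
  - exact: coef_a_cont cb.
  - exact: coef_B_cont cb.
  - exact: coef_be_cont cb.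
apply: continuous_cvg; first exact: cG.
exact: (cvg_pair (cvg_pair (cvg_pair cs cx) cy) co).
Qed.

Lemma weighted_norm_le (x y s yo k : R) :
  K s x y yo <= k -> `|weighted x y s yo| <= CG * k.
Proof.
move=> Kk; rewrite normrM mulrC (ger0_norm (potential_ge0 cb _ _ _ _)).
by apply: ler_pM => //; exact: potential_ge0 cb _ _ _ _.
Qed.

Lemma measurable_cut_weighted (D : set R) x y : measurable D ->
  D `<=` [set s | 0 < s] ->
  measurable_fun (setT : set (measurableTypeR R * measurableTypeR R))
    (cut D (weighted x y)).
Proof.
move=> mD D0; apply: measurable_cut => // z z0.
case: z z0 => s yo /= s0.
have c1 : fst z @[z --> (s, yo)] --> s by exact: cvg_fst.
have c2 : snd z @[z --> (s, yo)] --> yo by exact: cvg_snd.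
exact: (cvg_weighted _ s0 c1 (cvg_cst x) (cvg_cst y) c2).
Qed.

(** Near the characteristic [x = a s] the ratio [s / x] is close to [1 / a], which
    lies in the interior of the interval from [M^-1] to [M]. *)
Definition zone_ratio := 2 * C1 + 2 / b.
Notation M := zone_ratio.

Lemma zone_ratio_gt0 : 0 < M. Proof. by rewrite /zone_ratio; sign. Qed.
Let M_gt0 := zone_ratio_gt0.

Definition near_zone (x : R) : set R := `[x / M, M * x].

Lemma outside_near_zone (x y s : R) : 0 <= x -> 0 < s -> ~ near_zone x s ->
  b / 2 * s <= `|x - a y * s|.
Proof.
move=> x0 s0; rewrite /near_zone /= in_itv/= => /negP.
have abs : b * s <= a y * s by rewrite ler_pM2r.
have acs : a y * s <= C1 * s by rewrite ler_pM2r.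
rewrite negb_and -!ltNge => /orP[|].
- rewrite ltr_pdivlMr// /zone_ratio => xs.
  have bs : 0 < 2 / b * s by sign.
  have abC := le_trans (a_ge y) (a_le y).
  have C1s : b * s <= C1 * s by rewrite ler_pM2r.
  have b_s : 0 < b * s by sign.
  rewrite ger0_norm; last by move: xs; lra.
  by move: xs; lra.
- move=> xs.
  have x2 : 2 / b * x <= M * x.
    by apply: ler_wpM2r => //; rewrite /zone_ratio lerDr; sign.
  have {x2}xs : x < b / 2 * s.
    rewrite (_ : x = b / 2 * (2 / b * x)); last by field; nonzero.
    rewrite ltr_pM2l; last by sign.
    exact: le_lt_trans x2 xs.
  by rewrite ler0_norm; lra.
Qed.

Definition spatial_tail (y0 yo : R) := expR (- ((16 * T)^-1 * (yo - y0) ^+ 2)).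

Lemma integrable_tail y0 : mu.-integrable setT (EFin \o spatial_tail y0).
Proof.
have k0 : 0 < (16 * T)^-1 by sign.
have := integrable_affine (- y0) ltr01 (integrable_gaussian k0).
by congr (integrable _ _ (_ \o _)); apply/funext => z; rewrite /spatial_tail mul1r.
Qed.

Definition time_window (c : R) (s : R) := c * \1_(`]0, T[ : set R) s.

Lemma integrable_window c : mu.-integrable setT (EFin \o time_window c).
Proof.
rewrite (_ : _ \o _ = (fun s => c%:E * (\1_(`]0, T[ : set R) s)%:E)%E).
  apply: integrableZl => //; exact: integrable_indic_itv.
by apply/funext => s /=; rewrite EFinM.
Qed.

Lemma tensor_dominated_cut (D : set R) x y c y0 : 0 <= c -> D `<=` `]0, T[ ->
  (forall s yo, D s -> K s x y yo <= c * spatial_tail y0 yo) ->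
  tensor_dominated (time_window (CG * c)) (spatial_tail y0) (cut D (weighted x y)).
Proof.
move=> c0 DT Kc [s yo] /=; rewrite /cut /time_window normrM.
have [sD|sD] := boolP (s \in D).
  have Ds : D s by rewrite inE in sD.
  rewrite !indicE sD mem_set; last exact: DT.
  rewrite normr1 mul1r mulr1 -mulrA; exact: weighted_norm_le (Kc _ _ Ds).
rewrite indicE (negbTE sD) normr0 mul0r.
by rewrite !mulr_ge0 ?expR_ge0// ?indicE// ltW.
Qed.

Definition far_amplitude := far_const b C1 T * expR ((8 * T)^-1).

Lemma far_amplitude_ge0 : 0 <= far_amplitude.
Proof. by rewrite /far_amplitude /far_const; sign. Qed.

(** The dominating function depends neither on [x] nor on [y] near [y0]: this is
    the domination for the limit of the part away from the characteristic. *)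
Lemma far_dominated (D : set R) (x y y0 : R) : 0 <= x -> `|y - y0| <= 1 ->
  D `<=` `]0, T[ `\` near_zone x ->
  tensor_dominated (time_window (CG * far_amplitude)) (spatial_tail y0)
    (cut D (weighted x y)).
Proof.
move=> x0 yy0 DT; apply: tensor_dominated_cut; first exact: far_amplitude_ge0.
  by move=> s /DT[].
move=> s yo /DT[] /=; rewrite in_itv/= => sT ns.
have /andP[s0 _] := sT.
apply: le_trans (potential_far cb y sT (outside_near_zone yo x0 s0 ns)) _.
rewrite /far_amplitude /spatial_tail -[leRHS]mulrA -expRD ler_wpM2l ?ler_expR//.
  by rewrite /far_const; sign.
have y1 : (y - y0) ^+ 2 <= 1.
  by rewrite -(real_normK (num_real (y - y0))) expr_le1.
have -> : (yo - y) ^+ 2 / (8 * T) = (8 * T)^-1 * (yo - y) ^+ 2 by rewrite mulrC.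
have -> : (16 * T)^-1 * (yo - y0) ^+ 2 = (8 * T)^-1 * ((yo - y0) ^+ 2 / 2).
  by field; nonzero.
have key : 0 <= (8 * T)^-1 * (1 - (yo - y0) ^+ 2 / 2 + (yo - y) ^+ 2).
  by apply: mulr_ge0; [by sign|have := sqr_ge0 ((yo - y) - (y - y0)); lra].
by move: key; set c := (8 * T)^-1; lra.
Qed.

Definition all_time_amplitude (x y : R) :=
  far_amplitude + late_const B C1 C2 T y (x / M).

(** For a fixed [x > 0] the times near the characteristic are bounded below, so the
    whole potential is dominated, but not uniformly in [x]. *)
Lemma all_time_dominated (D : set R) (x y : R) : 0 < x -> D `<=` `]0, T[ ->
  tensor_dominated (time_window (CG * all_time_amplitude x y)) (spatial_tail y)
    (cut D (weighted x y)).
Proof.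
move=> x0 DT.
have lc0 : 0 <= late_const B C1 C2 T y (x / M).
  by rewrite /late_const; sign.
apply: tensor_dominated_cut => //.
  by rewrite /all_time_amplitude addr_ge0// far_amplitude_ge0.
move=> s yo /DT /=; rewrite in_itv/= => sT; have /andP[s0 sltT] := sT.
have tail0 : 0 <= spatial_tail y yo by rewrite /spatial_tail; sign.
rewrite /all_time_amplitude mulrDl; have [sx|xs] := ltP s (x / M).
  rewrite -[leLHS]addr0 lerD//; last by rewrite mulr_ge0.
  have ns : ~ near_zone x s.
    by rewrite /near_zone /= in_itv/= => /andP[]; rewrite leNgt sx.
  apply: le_trans (potential_far cb y sT (outside_near_zone yo (ltW x0) s0 ns)) _.
  rewrite /far_amplitude /spatial_tail -[leRHS]mulrA -expRD ler_wpM2l ?ler_expR//.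
    by rewrite /far_const; sign.
  have -> : (yo - y) ^+ 2 / (8 * T) = 2 * ((16 * T)^-1 * (yo - y) ^+ 2).
    by field; nonzero.
  have p1 : 0 <= (16 * T)^-1 * (yo - y) ^+ 2 by sign.
  have p2 : 0 < (8 * T)^-1 by sign.
  by move: p1 p2; set A := _ * _; lra.
rewrite -[leLHS]add0r lerD//; first by rewrite mulr_ge0// far_amplitude_ge0.
have xM : 0 < x / M by sign.
apply: le_trans (potential_late cb x y yo xM xs sltT) _.
by rewrite /spatial_tail [(16 * T)^-1 * _]mulrC.
Qed.

Lemma iterated_integrable_of_dominated (t x y c y0 : R) : t <= T ->
  tensor_dominated (time_window c) (spatial_tail y0) (cut `]0, t[ (weighted x y)) ->
  iterated_integrable t (weighted x y).
Proof.
move=> tT dF.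
have mF : measurable_fun (setT : set (measurableTypeR R * measurableTypeR R))
    (cut `]0, t[ (weighted x y)).
  apply: measurable_cut_weighted => // s.
  by rewrite /= in_itv/= => /andP[].
split.
  move=> s st; apply: (cut_section_integrable (integrable_tail y0) mF dF).
  by rewrite /= in_itv.
by have := cut_integrable _ (integrable_window c) (integrable_tail y0) mF dF; apply.
Qed.

Lemma iterated_integrable_interior (t x y : R) : 0 < x -> t <= T ->
  iterated_integrable t (weighted x y).
Proof.
move=> x0 tT; apply: iterated_integrable_of_dominated => //.
apply: all_time_dominated => // s; rewrite /= !in_itv/= => /andP[-> st].
exact: lt_le_trans tT.
Qed.

Lemma boundary_avoids_near_zone (t : R) : t <= T ->
  `]0, t[ `<=` `]0, T[ `\` near_zone 0.
Proof.
move=> tT s; rewrite /near_zone /= !in_itv/= => /andP[s0 st].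
rewrite s0 (lt_le_trans st tT) mulr0 mul0r; split => // /andP[_ ].
by rewrite leNgt s0.
Qed.

Lemma iterated_integrable_boundary (t y : R) : t <= T ->
  iterated_integrable t (weighted 0 y).
Proof.
move=> tT; apply: (@iterated_integrable_of_dominated t 0 y _ y) => //.
apply: far_dominated => //; first by rewrite subrr normr0.
exact: boundary_avoids_near_zone.
Qed.

End weighted_potential.

(** * The limit at the boundary, along sequences *)

Section boundary_limit.
Context {R : realType}.
Notation mu := (@lebesgue_measure R).
Variables (a B be : R -> R) (b C1 C2 T : R) (G : R * R * R * R -> R) (CG : R).
Hypotheses (cb : coefficient_bounds a B be b C1 C2) (T_gt0 : 0 < T)
  (cG : continuous G) (CG_gt0 : 0 < CG) (bG : forall z, `|G z| <= CG).

Let b_gt0 := coef_b_gt0 cb.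
Let C1_gt0 := coef_C1_gt0 cb.
Let C2_gt0 := coef_C2_gt0 cb.
Let a_ge := coef_a_ge cb.
Let a_le := coef_a_le cb.
Let B_gt0 := coef_B_gt0 cb.
Let a_gt0 y : 0 < a y. Proof. exact: lt_le_trans (a_ge y). Qed.

Notation K := (potential a B be).
Notation F := (weighted a B be G).
Notation M := (zone_ratio b C1).
Notation zone := (near_zone b C1).

Let M_gt0 : 0 < M := zone_ratio_gt0 cb.

Variables (t_ x_ y_ : nat -> R) (ts ys : R).
Hypotheses (ts_le : ts <= T)
  (ct : t_ n @[n --> \oo] --> ts) (cx : x_ n @[n --> \oo] --> 0)
  (cy : y_ n @[n --> \oo] --> ys)
  (t_le : forall n, t_ n <= T) (x_gt0 : forall n, 0 < x_ n)
  (x_le1 : forall n, x_ n <= 1) (xM : forall n, M * x_ n < t_ n)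
  (y_near : forall n, `|y_ n - ys| <= 1) (By : forall n, B ys / 2 <= B (y_ n)).

Let far_zone n : set R := `]0, t_ n[ `\` zone (x_ n).

Let measurable_near_zone x : measurable (zone x).
Proof. exact: measurable_itv. Qed.

Let measurable_far_zone n : measurable (far_zone n).
Proof. by apply: measurableD. Qed.

Lemma near_zone_sub n : zone (x_ n) `<=` `]0, t_ n[.
Proof.
move=> s; rewrite /near_zone /= !in_itv/= => /andP[xs sx].
rewrite (lt_le_trans _ xs) ?divr_gt0//=.
exact: le_lt_trans sx (xM n).
Qed.

(** Every positive time leaves the zone around the characteristic as [x] tends to
    [0], and there the integrand converges by continuity. *)
Lemma far_limit :
  \int[mu]_(s in far_zone n) \int[mu]_yo F (x_ n) (y_ n) s yo @[n --> \oo]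
    --> \int[mu]_(s in `]0, ts[) \int[mu]_yo F 0 ys s yo.
Proof.
rewrite Rintegral_cut; under eq_fun do rewrite Rintegral_cut.
apply: (@iterated_dominated_convergence _
    (time_window T (CG * far_amplitude b C1 T)) (spatial_tail T ys) ts
    (fun n => cut (far_zone n) (F (x_ n) (y_ n))) (cut `]0, ts[ (F 0 ys))).
- exact: integrable_window.
- exact: integrable_tail.
- move=> n; apply: (measurable_cut_weighted cb cG) => // s [].
  by rewrite /= in_itv/= => /andP[].
- apply: (measurable_cut_weighted cb cG) => // s.
  by rewrite /= in_itv/= => /andP[].
- move=> n; apply: (far_dominated cb T_gt0 CG_gt0 bG) => //; first exact: ltW.
  move=> s []; rewrite /= !in_itv/= => /andP[s0 st] ns; split => //.
  by rewrite s0 (lt_le_trans st).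
- apply: (far_dominated cb T_gt0 CG_gt0 bG) => //.
    by rewrite subrr normr0.
  exact: boundary_avoids_near_zone.
- move=> s yo sts; rewrite /cut /=.
  have cMx : M * x_ n @[n --> \oo] --> 0.
    have h : M * x_ n @[n --> \oo] --> M * 0 by apply: cvgM cx; exact: cvg_cst.
    by rewrite mulr0 in h.
  have [s0|s0] := leP s 0.
    have E (D : set R) : D `<=` [set r | 0 < r] -> \1_D s = 0 :> R.
      move=> D0; rewrite indicE memNset// => /D0 /=; by rewrite ltNge s0.
    have Efar n : \1_(far_zone n) s = 0 :> R.
      by apply: E => r []; rewrite /= in_itv/= => /andP[].
    rewrite E ?mul0r; last by move=> r; rewrite /= in_itv/= => /andP[].
    by under eq_fun do rewrite Efar mul0r; exact: cvg_cst.
  have [st|ts_s|/eqP] := ltgtP s ts; last by rewrite (negbTE sts).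
  + have -> : \1_(`]0, ts[ : set R) s = 1 :> R.
      by rewrite indicE mem_set//= in_itv/= s0.
    rewrite mul1r.
    have cF : F (x_ n) (y_ n) s yo @[n --> \oo] --> F 0 ys s yo.
      by apply: (cvg_weighted cb cG) => //; exact: cvg_cst.
    apply: cvg_trans cF; apply: near_eq_cvg.
    near=> n; rewrite indicE mem_set ?mul1r//; split.
      rewrite /= in_itv/= s0/=; near: n.
      exact: (cvgr_gt ts ct).
    rewrite /near_zone /= in_itv/= => /andP[_]; apply/negP; rewrite -ltNge.
    by near: n; exact: (cvgr_lt 0 cMx).
  + have -> : \1_(`]0, ts[ : set R) s = 0 :> R.
      by rewrite indicE memNset//= in_itv/= s0/= ltNge ltW.
    rewrite mul0r; apply: cvg_near_cst.
    near=> n; rewrite indicE memNset ?mul0r// => -[]; rewrite /= in_itv/= s0/=.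
    rewrite ltNge => /negP + _; apply; apply: ltW.
    by near: n; exact: (cvgr_lt ts ct).
Unshelve. all: by end_near.
Qed.

Lemma cut_rescaled (x y u v xi : R) :
  let w := Num.sqrt x in let sg := (1 + w * u) / a y in
  0 < x -> a (y + w * v) - a y = - B xi * (w * v) ->
  w ^+ 3 / a y * w *
    cut (zone x) (F x y) (w ^+ 3 / a y * u + w ^+ 2 / a y, w * v + y) =
  \1_(`[M^-1, M] : set R) sg *
  (profile (a (y + w * v) / a y) (B (y + w * v)) (B xi)
    (be (y + w * v) * (w * Num.sqrt sg)) sg u v *
   G (w ^+ 2 * sg, x, y, y + w * v)).
Proof.
move=> w sg x0 mean; have w0 : 0 < w by rewrite sqrtr_gt0.
have ay0 := a_gt0 y.
have xE : x = w ^+ 2 by rewrite sqr_sqrtr// ltW.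
have sE : w ^+ 3 / a y * u + w ^+ 2 / a y = w ^+ 2 * sg.
  by rewrite /sg; move: (w) w0 => r r0; field; nonzero.
rewrite sE [w * v + y]addrC /cut /=.
have -> : \1_(zone x) (w ^+ 2 * sg) = \1_(`[M^-1, M] : set R) sg :> R.
  rewrite !indicE /near_zone !mem_setE !in_itv/= xE.
  by rewrite ler_pM2l ?exprn_gt0// [M * _]mulrC ler_pM2l ?exprn_gt0.
rewrite indicE; case: (boolP (sg \in _)) => [|_]; last by rewrite mul0r mulr0 mul0r.
rewrite inE /= in_itv/= => /andP[Msg _].
have sg0 : 0 < sg by apply: lt_le_trans Msg; rewrite invr_gt0.
have := potential_rescaled cb w0 sg0 mean; rewrite -/sg => <-.
rewrite !mul1r /weighted -xE !mulrA; congr (_ * _ * _).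
by move: (w) => r; ring.
Qed.

Let xi_ n v : R :=
  projT1 (cid2 (coef_a_mean cb (y_ n) (y_ n + Num.sqrt (x_ n) * v))).

Let xi_near n v : `|xi_ n v - y_ n| <= `|Num.sqrt (x_ n) * v|.
Proof.
by rewrite /xi_; case: cid2 => xi /= h _; rewrite addrAC subrr add0r in h.
Qed.

Let xi_mean n v : a (y_ n + Num.sqrt (x_ n) * v) - a (y_ n) =
  - B (xi_ n v) * (Num.sqrt (x_ n) * v).
Proof. by rewrite /xi_; case: cid2 => xi /= _ ->; rewrite addrAC subrr add0r. Qed.

(** The integrand around the characteristic, in the rescaled variables. *)
Let psi n (z : R * R) : R :=
  let w := Num.sqrt (x_ n) in
  w ^+ 3 / a (y_ n) * w *
    cut (zone (x_ n)) (F (x_ n) (y_ n))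
      (w ^+ 3 / a (y_ n) * z.1 + w ^+ 2 / a (y_ n), w * z.2 + y_ n).

Let psi_lim (z : R * R) : R :=
  profile 1 (B ys) (B ys) 0 (a ys)^-1 z.1 z.2 * G (0, 0, ys, ys).

Let measurable_near n :
  measurable_fun (setT : set (measurableTypeR R * measurableTypeR R))
    (cut (zone (x_ n)) (F (x_ n) (y_ n))).
Proof.
apply: (measurable_cut_weighted cb cG) => // s.
rewrite /near_zone /= in_itv/= => /andP[xs _]; apply: lt_le_trans xs.
by rewrite divr_gt0.
Qed.

Let measurable_psi n :
  measurable_fun (setT : set (measurableTypeR R * measurableTypeR R)) (psi n).
Proof.
apply: measurable_funM; first exact: measurable_cst.
apply: (measurableT_comp (measurable_near n)).
apply: measurable_fun_pair.
  exact: (measurableT_comp (measurable_affine _ _) measurable_fst).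
exact: (measurableT_comp (measurable_affine _ _) measurable_snd).
Qed.

Let gauss_u (u : R) : R :=
  CG * rescaled_const b C1 C2 T M (B ys / 2) *
  expR (- (rescaled_rate C1 M * u ^+ 2)).
Let gauss_v (v : R) : R := expR (- (rescaled_rate C1 M * v ^+ 2)).

Let rate_gt0 : 0 < rescaled_rate C1 M.
Proof. by rewrite /rescaled_rate; sign. Qed.

Let psiE n u v : psi n (u, v) =
  let w := Num.sqrt (x_ n) in let sg := (1 + w * u) / a (y_ n) in
  \1_(`[M^-1, M] : set R) sg *
  (profile (a (y_ n + w * v) / a (y_ n)) (B (y_ n + w * v)) (B (xi_ n v))
    (be (y_ n + w * v) * (w * Num.sqrt sg)) sg u v *
   G (w ^+ 2 * sg, x_ n, y_ n, y_ n + w * v)).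
Proof. exact: cut_rescaled (x_gt0 n) (xi_mean n v). Qed.

Let psi_dominated n : tensor_dominated gauss_u gauss_v (psi n).
Proof.
move=> [u v]; rewrite psiE /=.
set w := Num.sqrt _; set sg := _ / a _.
have w0 : 0 < w by rewrite sqrtr_gt0.
have w1 : w <= 1 by rewrite -sqrtr1 ler_sqrt.
have BB : 0 < B ys / 2 by sign.
have cst0 : 0 <= rescaled_const b C1 C2 T M (B ys / 2).
  by rewrite /rescaled_const; sign.
have G0 : 0 <= gauss_u u * gauss_v v by rewrite /gauss_u /gauss_v; sign.
rewrite indicE; have [|_] := boolP (sg \in _); last by rewrite mul0r normr0.
rewrite inE /= in_itv/= => zsg; have /andP[Msg sgM] := zsg.
have sg0 : 0 < sg by apply: lt_le_trans Msg; rewrite invr_gt0.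
rewrite mul1r normrM /gauss_u /gauss_v mulrC.
have xE : w ^+ 2 = x_ n by rewrite sqr_sqrtr// ltW.
have rT : (be (y_ n + w * v) * (w * Num.sqrt sg)) ^+ 2 <= C1 ^+ 2 * T.
  rewrite !exprMn xE sqr_sqrtr; last exact: ltW.
  apply: ler_pM; [by sign|by sign| |].
    rewrite -(real_normK (num_real (be _))) lerXn2r ?nnegrE//; first exact: ltW.
    exact: coef_be_le cb _.
  rewrite mulrC; apply: (@le_trans _ _ (M * x_ n)).
    by rewrite ler_pM2r.
  exact: le_trans (ltW (xM n)) (t_le n).
have bound := profile_bound cb u v (xi_ n v) T_gt0 M_gt0 BB (By n) _ zsg rT.
rewrite -2!mulrA; apply: ler_pM => //.
have p0 : 0 <= profile (a (y_ n + w * v) / a (y_ n)) (B (y_ n + w * v))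
    (B (xi_ n v)) (be (y_ n + w * v) * (w * Num.sqrt sg)) sg u v.
  by rewrite /profile; sign.
by rewrite (ger0_norm p0); apply: bound; rewrite w0.
Qed.

Let psi_cvg u v : psi n (u, v) @[n --> \oo] --> psi_lim (u, v).
Proof.
have cw : Num.sqrt (x_ n) @[n --> \oo] --> (0 : R).
  by rewrite -[0]sqrtr0; apply: continuous_cvg cx; exact: sqrt_continuous.
have cwv : Num.sqrt (x_ n) * v @[n --> \oo] --> (0 : R).
  by rewrite -(mul0r v); apply: cvgM => //; exact: cvg_cst.
have cyo : y_ n + Num.sqrt (x_ n) * v @[n --> \oo] --> ys.
  by rewrite -[ys]addr0; exact: cvgD.
have cxi : xi_ n v @[n --> \oo] --> ys.
  have c0 : xi_ n v - y_ n @[n --> \oo] --> (0 : R).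
    apply/norm_cvg0P.
    apply: (@squeeze_cvgr _ _ _ _ (cst 0) (fun n => `|Num.sqrt (x_ n) * v|)).
    - by apply: nearW => n; rewrite /= normr_ge0 xi_near.
    - exact: cvg_cst.
    - by rewrite -(@normr0 _ R); exact: cvg_norm.
  have -> : xi_^~ v = (fun n => xi_ n v - y_ n + y_ n).
    by apply/funext => n; rewrite subrK.
  by rewrite -[ys]add0r; exact: cvgD.
have ay0 := a_gt0 ys.
have ca : a (y_ n) @[n --> \oo] --> a ys.
  by apply: continuous_cvg cy; exact: coef_a_cont cb _.
have cao : a (y_ n + Num.sqrt (x_ n) * v) @[n --> \oo] --> a ys.
  by apply: continuous_cvg cyo; exact: coef_a_cont cb _.
have csg : (1 + Num.sqrt (x_ n) * u) / a (y_ n) @[n --> \oo] --> (a ys)^-1.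
  have c1 : 1 + Num.sqrt (x_ n) * u @[n --> \oo] --> 1 + 0 * u.
    by apply: cvgD; [exact: cvg_cst|apply: cvgM => //; exact: cvg_cst].
  rewrite mul0r addr0 in c1; rewrite -[(a ys)^-1]mul1r.
  by apply: cvgM => //; apply: cvgV => //; nonzero.
rewrite /psi_lim -[X in _ --> X]mul1r.
under eq_fun do rewrite psiE.
apply: cvgM.
  apply: cvg_near_cst.
  have Mlo : M^-1 < (a ys)^-1.
    rewrite ltf_pV2 ?posrE// (le_lt_trans (a_le ys))// /zone_ratio.
    have b2 : 0 < 2 / b by sign.
    by move: b2; set q := 2 / b; have := C1_gt0; lra.
  have Mhi : (a ys)^-1 < M.
    have ab : (a ys)^-1 <= b^-1 by rewrite lef_pV2 ?posrE.
    have b1 : 0 < b^-1 by sign.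
    by move: ab b1; rewrite /zone_ratio; have := C1_gt0; lra.
  near=> n; rewrite indicE mem_set// /= in_itv/=; apply/andP; split; apply: ltW.
    by near: n; exact: (cvgr_gt _ csg).
  by near: n; exact: (cvgr_lt _ csg).
have csq : Num.sqrt ((1 + Num.sqrt (x_ n) * u) / a (y_ n)) @[n --> \oo]
    --> Num.sqrt (a ys)^-1.
  by apply: continuous_cvg csg; exact: sqrt_continuous.
apply: cvgM.
  apply: cvg_profile => //.
  - by sign.
  - rewrite -(divff (lt0r_neq0 ay0)); apply: cvgM => //.
    by apply: cvgV => //; nonzero.
  - by apply: continuous_cvg cyo; exact: coef_B_cont cb _.
  - by apply: continuous_cvg cxi; exact: coef_B_cont cb _.
  - rewrite -(mulr0 (be ys)); apply: cvgM.
      by apply: continuous_cvg cyo; exact: coef_be_cont cb _.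
    by rewrite -(mul0r (Num.sqrt (a ys)^-1)); exact: cvgM.
have cs : Num.sqrt (x_ n) ^+ 2 * ((1 + Num.sqrt (x_ n) * u) / a (y_ n))
    @[n --> \oo] --> (0 : R).
  rewrite -[0](mul0r (a ys)^-1); apply: cvgM => //.
  by rewrite -[0](mul0r (0 : R)); exact: cvgM.
apply: continuous_cvg; first exact: cG.
exact: (cvg_pair (cvg_pair (cvg_pair cs cx) cy) cyo).
Unshelve. all: by end_near.
Qed.

Let psi_lim_dominated : tensor_dominated gauss_u gauss_v psi_lim.
Proof.
move=> [u v]; have h := @psi_cvg u v.
have dom n := psi_dominated n (u, v).
rewrite ler_norml; apply/andP; split.
  apply: (cvgr_to_ge h); apply: nearW => n.
  by have := dom n; rewrite ler_norml => /andP[].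
apply: (cvgr_to_le h); apply: nearW => n.
by have := dom n; rewrite ler_norml => /andP[].
Qed.

Let measurable_psi_lim :
  measurable_fun (setT : set (measurableTypeR R * measurableTypeR R)) psi_lim.
Proof.
apply: (@measurable_fun_cvg _ _ R setT psi psi_lim) => // -[u v] _.
exact: psi_cvg.
Qed.

(** In the rescaled variables the mass around the characteristic no longer
    concentrates, so dominated convergence applies: the density tends to a
    probability density and the weight [G] to its value at the boundary point. *)
Lemma near_limit :
  \int[mu]_(s in zone (x_ n)) \int[mu]_yo F (x_ n) (y_ n) s yo @[n --> \oo]
    --> G (0, 0, ys, ys).
Proof.
have iu : mu.-integrable setT (EFin \o gauss_u).
  rewrite (_ : _ \o _ = (fun u => (CG * rescaled_const b C1 C2 T M (B ys / 2))%:E *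
      (expR (- (rescaled_rate C1 M * u ^+ 2)))%:E)%E).
    by apply: integrableZl => //; exact: integrable_gaussian.
  by apply/funext => u /=; rewrite EFinM.
have iv : mu.-integrable setT (EFin \o gauss_v) by exact: integrable_gaussian.
have zT n : zone (x_ n) `<=` `]0, T[.
  move=> s /(@near_zone_sub n); rewrite /= !in_itv/= => /andP[-> st].
  exact: lt_le_trans (t_le n).
have E n : \int[mu]_(s in zone (x_ n)) \int[mu]_yo F (x_ n) (y_ n) s yo =
    \int[mu]_u \int[mu]_v psi n (u, v).
  rewrite Rintegral_cut.
  have w0 : 0 < Num.sqrt (x_ n) by rewrite sqrtr_gt0.
  have ay0 := a_gt0 (y_ n).
  have k0 : 0 < Num.sqrt (x_ n) ^+ 3 / a (y_ n) by sign.
  exact: (iterated_Rintegral_affine _ _ k0 w0 (integrable_window T _)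
    (integrable_tail T_gt0 (y_ n)) (measurable_near n)
    (all_time_dominated cb T_gt0 CG_gt0 bG (y_ n) (x_gt0 n) (@zT n))).
under eq_fun do rewrite E.
have limE : \int[mu]_u \int[mu]_v psi_lim (u, v) = G (0, 0, ys, ys).
  by rewrite /psi_lim /= Rintegral_profile.
rewrite -limE.
exact: (@iterated_dominated_convergence _ gauss_u gauss_v 0 psi psi_lim).
Qed.

Lemma boundary_limit :
  \int[mu]_(s in `]0, t_ n[) \int[mu]_yo F (x_ n) (y_ n) s yo @[n --> \oo]
    --> G (0, 0, ys, ys) + \int[mu]_(s in `]0, ts[) \int[mu]_yo F 0 ys s yo.
Proof.
have E n : \int[mu]_(s in `]0, t_ n[) \int[mu]_yo F (x_ n) (y_ n) s yo =
    \int[mu]_(s in zone (x_ n)) \int[mu]_yo F (x_ n) (y_ n) s yo +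
    \int[mu]_(s in far_zone n) \int[mu]_yo F (x_ n) (y_ n) s yo.
  have U : `]0, t_ n[%classic = zone (x_ n) `|` far_zone n.
    rewrite /far_zone setDE setUIr setUv setIT.
    by apply/esym/setUidPr; exact: near_zone_sub.
  have [_] := iterated_integrable_interior cb T_gt0 cG CG_gt0 bG (y_ n)
    (x_gt0 n) (t_le n).
  rewrite U => iJ; apply: Rintegral_setU iJ _ => //.
  - exact: measurable_near_zone.
  - exact: measurable_far_zone.
  - by apply/disj_setPS => s [] zs [].
under eq_fun do rewrite E.
by apply: cvgD; [exact: near_limit|exact: far_limit].
Qed.

End boundary_limit.

(** * From sequences to filters, and the coefficients on the axis *)

Section sequential_limits.
Context {R : realType} (U : pseudoMetricType R).

(** Balls of radius [1 / n] form a countable base of neighbourhoods; the sequences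
    may moreover be taken in any property that holds near the limit. *)
Lemma cvg_within_seq (f : U -> R) (D P : set U) (p0 : U) (l : R) :
  (\forall p \near within D (nbhs p0), P p) ->
  (forall u : nat -> U, (forall n, D (u n)) -> (forall n, P (u n)) ->
     u n @[n --> \oo] --> p0 -> f (u n) @[n --> \oo] --> l) ->
  f @ within D (nbhs p0) --> l.
Proof.
move=> nP H; apply/cvgrPdist_lt => e e0; apply: contrapT => nnear.
have pick n : exists p, [/\ D p, P p, ball p0 n.+1%:R^-1 p & ~ (`|l - f p| < e)].
  apply: contrapT => /forallNP none; apply: nnear.
  have nb : \forall p \near within D (nbhs p0), ball p0 n.+1%:R^-1 p.
    by apply: cvg_within; apply: nbhsx_ballx; rewrite invr_gt0.
  have nD : \forall p \near within D (nbhs p0), D p by exact: withinT.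
  near=> p; apply: contrapT => npe; apply: (none p); split => //.
  - by near: p.
  - by near: p.
  - by near: p.
pose u n := projT1 (cid (pick n)).
have uP n : [/\ D (u n), P (u n), ball p0 n.+1%:R^-1 (u n) &
    ~ (`|l - f (u n)| < e)].
  by rewrite /u; case: cid.
have cu : u n @[n --> \oo] --> p0.
  apply/cvg_ballP => d d0; near=> n.
  have [_ _ + _] := uP n; apply: le_ball; apply: ltW.
  by near: n; exact: near_infty_natSinv_lt (PosNum d0).
have := H u (fun n => let: And4 h _ _ _ := uP n in h)
  (fun n => let: And4 _ h _ _ := uP n in h) cu.
move=> /cvgrPdist_lt /(_ _ e0) [N _ /(_ N (leqnn N))] /= h.
by have [_ _ _] := uP N.
Unshelve. all: by end_near.
Qed.

End sequential_limits.

Section restriction_to_axis.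
Context {R : realType}.
Implicit Types f : R * R -> R.

Lemma continuous_axis f : (forall p, differentiable f p) ->
  continuous (fun y : R => f (0, y)).
Proof.
move=> df y; apply: (@cvg_comp _ _ _ (fun y : R => (0 : R, y)) f _
  (nbhs (0 : R, y))).
  exact: (cvg_pair (cvg_cst (0 : R)) cvg_id).
exact: differentiable_continuous (df (0, y)).
Qed.

Lemma is_derive_axis f y : (forall p, differentiable f p) ->
  is_derive y (1 : R) (fun z : R => f (0, z)) (pdy f (0, y)).
Proof.
move=> df.
have E : (fun h : R =>
      h^-1 *: ((f \o shift (0, y)) (h *: ((0, 1) : R * R)) - f (0, y))) =
    (fun h : R =>
      h^-1 *: (((fun z : R => f (0, z)) \o shift y) (h *: (1 : R)) - f (0, y))).
  apply/funext => h; congr (_ *: (f _ - _)).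
  by rewrite /shift /=; congr pair; rewrite /= ?scaler0 ?addr0.
have dv : derivable f (0, y) (0, 1) by exact: diff_derivable.
split.
  by move: dv; rewrite /derivable E.
by rewrite /pdy /derive E.
Qed.

End restriction_to_axis.

Section coefficients.
Context {R : realType}.
Variables (b1 b2 : R * R -> R) (C1 C2 : R).
Hypotheses (b1_smooth : Cinfty_bounded b1) (b2_smooth : Cinfty_bounded b2)
  (C1_gt0 : 0 < C1)
  (b1_le : forall i j : nat, (i + j <= 3)%N -> forall p, `|pd i j b1 p| <= C1)
  (b2_le : forall i j : nat, (i + j <= 1)%N -> forall p, `|pd i j b2 p| <= C1)
  (B_gt0 : forall p, 0 < pdy b1 p)
  (b_gt0 : 0 < inf [set - b1 (0, y) | y in [set: R]])
  (C2_gt0 : 0 < C2)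
  (b1_le_B : forall i j : nat, (1 <= i + j <= 3)%N ->
     forall p, `|pd i j b1 p| <= C2 * pdy b1 p).

Lemma mean_value (f df : R -> R) (y z : R) :
  (forall x, is_derive x (1 : R) f (df x)) ->
  exists2 xi, `|xi - y| <= `|z - y| & f z - f y = df xi * (z - y).
Proof.
move=> fd.
have cf : continuous f.
  move=> x; apply: differentiable_continuous; apply/derivable1_diffP.
  by case: (fd x).
have [yz|zy|->] := ltgtP y z; last by exists z; rewrite !subrr ?mulr0.
- have [|xi] := MVT yz (fun x _ => fd x); first exact: continuous_subspaceT.
  rewrite in_itv/= => /andP[h1 h2] E; exists xi => //.
  by rewrite !ger0_norm ?subr_ge0; [lra|exact: ltW|exact: ltW].
- have [|xi] := MVT zy (fun x _ => fd x); first exact: continuous_subspaceT.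
  rewrite in_itv/= => /andP[h1 h2] E; exists xi.
    by rewrite !ler0_norm ?subr_le0; [lra|exact: ltW|exact: ltW].
  by rewrite -opprB E -mulrN opprB.
Qed.

Let Cn1_diff n (f : R * R -> R) : Cn n.+1 f -> forall p, differentiable f p.
Proof. by case. Qed.

Let diff_b1 : forall p, differentiable b1 p.
Proof. exact: Cn1_diff (b1_smooth.1 1%N). Qed.

Let diff_B : forall p, differentiable (pdy b1) p.
Proof. by have [_ _ []] := b1_smooth.1 2%N. Qed.

Let diff_b2 : forall p, differentiable b2 p.
Proof. exact: Cn1_diff (b2_smooth.1 1%N). Qed.

(** By [b1_le_B] the logarithmic derivative of [B] along the axis is bounded by
    [C2]. *)
Let B_decay y z :
  pdy b1 (0, y) * expR (- (C2 * `|z - y|)) <= pdy b1 (0, z).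
Proof.
have dln x : is_derive x (1 : R) (fun r : R => ln (pdy b1 (0, r)))
    (pdy (pdy b1) (0, x) / pdy b1 (0, x)).
  have h := is_derive_axis x diff_B.
  have hl := @is_derive1_ln R _ (B_gt0 (0, x)).
  by have := is_derive1_comp hl h; rewrite mulrC.
have [xi _ E] := mean_value y z dln.
have bnd : `|pdy (pdy b1) (0, xi) / pdy b1 (0, xi)| <= C2.
  rewrite normrM normfV (gtr0_norm (B_gt0 _)) ler_pdivrMr//.
  exact: (b1_le_B (i := 0%N) (j := 2%N)).
have low : - (C2 * `|z - y|) <= ln (pdy b1 (0, z)) - ln (pdy b1 (0, y)).
  rewrite E lerNl (le_trans (ler_norm _))// normrN normrM.
  by rewrite ler_wpM2r.
have : expR (ln (pdy b1 (0, y)) + - (C2 * `|z - y|)) <= expR (ln (pdy b1 (0, z))).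
  by rewrite ler_expR; lra.
by rewrite expRD !lnK ?posrE.
Qed.

Lemma coefficient_bounds_axis :
  coefficient_bounds (fun y => - b1 (0, y)) (fun y => pdy b1 (0, y))
    (fun y => b2 (0, y)) (inf [set - b1 (0, y) | y in [set: R]]) C1 C2.
Proof.
have b1C p : `|b1 p| <= C1 := b1_le (i := 0%N) (j := 0%N) isT p.
have BC p : `|pdy b1 p| <= C1 := b1_le (i := 0%N) (j := 1%N) isT p.
split => //.
- by move=> y; apply: cvgN; exact: continuous_axis.
- exact: continuous_axis.
- exact: continuous_axis.
- move=> y; apply: ge_inf; last by exists y.
  exists (- C1) => _ [z _ <-]; rewrite lerN2.
  exact: le_trans (ler_norm _) (b1C _).
- by move=> y; apply: le_trans (b1C (0, y)); rewrite -normrN ler_norm.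
- by move=> y; exact: le_trans (ler_norm _) (BC _).
- by move=> y; exact: (b2_le (i := 0%N) (j := 0%N)).
- move=> y z.
  have d x : is_derive x (1 : R) (fun r : R => b1 (0, r)) (pdy b1 (0, x)).
    exact: is_derive_axis.
  have [xi h E] := mean_value y z d; exists xi => //.
  by rewrite mulNr -E; lra.
Qed.

End coefficients.

(** * Extension of the weight by clamping *)

Section clamping.
Context {R : realType}.

Lemma cvg_maxr (I : Type) (F : set_system I) (FF : Filter F) (f : I -> R)
    (l c : R) :
  f @ F --> l -> Num.max (f i) c @[i --> F] --> Num.max l c.
Proof.
move=> fl; rewrite maxr_absE; under eq_fun do rewrite maxr_absE.
apply: cvgM; last exact: cvg_cst.
have d : f i - c @[i --> F] --> l - c by apply: cvgB => //; exact: cvg_cst.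
by apply: cvgD; [apply: cvgD => //; exact: cvg_cst|exact: cvg_norm d].
Qed.

Lemma cvg_minr (I : Type) (F : set_system I) (FF : Filter F) (f : I -> R)
    (l c : R) :
  f @ F --> l -> Num.min (f i) c @[i --> F] --> Num.min l c.
Proof.
move=> fl; rewrite minr_absE; under eq_fun do rewrite minr_absE.
apply: cvgM; last exact: cvg_cst.
have d : f i - c @[i --> F] --> l - c by apply: cvgB => //; exact: cvg_cst.
by apply: cvgB; [apply: cvgD => //; exact: cvg_cst|exact: cvg_norm d].
Qed.

Variables (g : R * R * R * R -> R) (T tm : R).
Hypotheses (tm0 : 0 <= tm) (tmT : tm < T).

Let S : set (R * R * R * R) := `[0, T[ `*` `[0, +oo[ `*` [set: R] `*` [set: R].

(** A retraction onto part of the domain of [g]: composing [g] with it gives a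
    weight that is continuous and bounded on the whole space, and that agrees with
    [g] at the times between [0] and [tm] and at the points with [x >= 0]. *)
Definition clamp (z : R * R * R * R) : R * R * R * R :=
  (Num.min (Num.max z.1.1.1 0) tm, Num.max z.1.1.2 0, z.1.2, z.2).

Lemma clamp_in z : S (clamp z).
Proof.
rewrite /S /clamp; do 2!split => //; split; rewrite /= !in_itv/=.
  by rewrite le_min tm0 le_max lexx orbT/= gt_min tmT orbT.
by rewrite le_max lexx orbT.
Qed.

Lemma clamp_id s x y yo : 0 <= s <= tm -> 0 <= x ->
  clamp (s, x, y, yo) = (s, x, y, yo).
Proof.
by move=> /andP[s0 st] x0; rewrite /clamp /= (max_l s0) (max_l x0) (min_l st).
Qed.

Lemma continuous_clamp : continuous clamp.
Proof.
move=> z.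
have c1 : z1.1.1.1 @[z1 --> z] --> z.1.1.1.
  apply: (@cvg_comp _ _ _ fst (fun z : R * R * R => z.1.1)); first exact: cvg_fst.
  by apply: (@cvg_comp _ _ _ fst (fun z : R * R => z.1)); exact: cvg_fst.
have c2 : z1.1.1.2 @[z1 --> z] --> z.1.1.2.
  apply: (@cvg_comp _ _ _ fst (fun z : R * R * R => z.1.2)); first exact: cvg_fst.
  apply: (@cvg_comp _ _ _ fst (fun z : R * R => z.2)); first exact: cvg_fst.
  exact: cvg_snd.
have c3 : z1.1.2 @[z1 --> z] --> z.1.2.
  apply: (@cvg_comp _ _ _ fst (fun z : R * R * R => z.2)); first exact: cvg_fst.
  exact: cvg_snd.
have c4 : z1.2 @[z1 --> z] --> z.2 by exact: cvg_snd.
have m1 : Num.max z1.1.1.1 0 @[z1 --> z] --> Num.max z.1.1.1 0 by exact: cvg_maxr.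
have m2 : Num.min (Num.max z1.1.1.1 0) tm @[z1 --> z] -->
    Num.min (Num.max z.1.1.1 0) tm by exact: cvg_minr.
have m3 : Num.max z1.1.1.2 0 @[z1 --> z] --> Num.max z.1.1.2 0 by exact: cvg_maxr.
exact: (cvg_pair (cvg_pair (cvg_pair m2 m3) c3) c4).
Qed.

Hypothesis g_Cb : Cb S g.

Lemma continuous_comp_clamp : continuous (g \o clamp).
Proof.
move=> z.
have /subspace_continuousP/(_ _ (clamp_in z)) cg := g_Cb.1.
apply: (@cvg_comp _ _ _ clamp g (nbhs z) (within S (nbhs (clamp z)))) cg.
move=> A nA.
have nP : nbhs z (clamp @^-1` [set p | S p -> A p]) by exact: continuous_clamp nA.
by apply: filterS nP => z1 /= h; apply: h; exact: clamp_in.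
Qed.

End clamping.

(** * The theorem *)

Lemma eq_iterated_integrable {R : realType} (t : R) (F F' : R -> R -> R) :
  (forall s yo, 0 < s < t -> F s yo = F' s yo) ->
  iterated_integrable t F -> iterated_integrable t F'.
Proof.
move=> FF' [inner outer]; have E s : 0 < s < t -> F s = F' s.
  by move=> st; apply/funext => yo; exact: FF'.
split=> [s st|]; first by rewrite -E//; exact: inner.
apply: eq_integrable outer => // s; rewrite inE /= in_itv/= => st.
by rewrite E.
Qed.

Theorem proposition5p7 (R : realType) (T : R) (b1 b2 c : R * R -> R) (C1 C2 : R)
  (T_gt0 : 0 < T)
  (b1_smooth : Cinfty_bounded b1)
  (b2_smooth : Cinfty_bounded b2)
  (c_smooth : Cinfty_bounded c)
  (C1_gt0 : 0 < C1)
  (b1_le : forall i j : nat, (i + j <= 3)%N -> forall p, `|pd i j b1 p| <= C1)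
  (b2_le : forall i j : nat, (i + j <= 1)%N -> forall p, `|pd i j b2 p| <= C1)
  (c_le : forall p, `|c p| <= C1)
  (B_gt0 : forall p, 0 < pdy b1 p)
  (b_gt0 : 0 < inf [set - b1 (0, y) | y in [set: R]])
  (C2_gt0 : 0 < C2)
  (b1_le_B : forall i j : nat, (1 <= i + j <= 3)%N ->
     forall p, `|pd i j b1 p| <= C2 * pdy b1 p)
  (g : R * R * R * R -> R)
  (g_Cb : Cb (`[0, T[ `*` `[0, +oo[ `*` [set: R] `*` [set: R]
               : set (R * R * R * R)) g)
  (tstar ystar : R) (tstar_in : 0 < tstar < T) :
  let mu := @lebesgue_measure R in
  let F (x y s yo : R) := boundary_kernel b1 b2 yo s x y * g (s, x, y, yo) in
  let D0 : set (R * R * R) := `]0, T[ `*` `]0, +oo[ `*` [set: R] in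
  [/\ forall t x y, D0 (t, x, y) -> iterated_integrable t (F x y),
      iterated_integrable tstar (F 0 ystar)
    & (fun p : R * R * R => \int[mu]_(s in `]0, p.1.1[)
         \int[mu]_(yo in [set: R]) F p.1.2 p.2 s yo)
        @ within D0 (nbhs ((tstar, 0, ystar) : R * R * R))
      --> g (0, 0, ystar, ystar)
          + \int[mu]_(s in `]0, tstar[)
              \int[mu]_(yo in [set: R]) F 0 ystar s yo].
Proof.
move=> mu F D0.
have cb := coefficient_bounds_axis b1_smooth b2_smooth C1_gt0 b1_le b2_le B_gt0
  b_gt0 C2_gt0 b1_le_B.
set a := (fun y => - b1 (0, y)) in cb; set B := (fun y => pdy b1 (0, y)) in cb.
set be := (fun y => b2 (0, y)) in cb; set b := inf _ in cb b_gt0.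
have [CG CG_gt0 gCG] := pinfty_ex_gt0 g_Cb.2.
have /andP[ts0 tsT] := tstar_in.
have FE tm s x y yo : 0 < s <= tm -> 0 <= x ->
    weighted a B be (g \o clamp tm) x y s yo = F x y s yo.
  move=> /andP[s0 st] x0; rewrite /weighted /F /= clamp_id ?(ltW s0)//.
  rewrite boundary_kernelE//; have := coef_a_ge cb yo; rewrite /a => ba.
  by rewrite -oppr_ge0 (le_trans _ ba)// ltW.
have cG tm : 0 <= tm -> tm < T -> continuous (g \o clamp tm).
  by move=> tm0 tmT; exact: continuous_comp_clamp g_Cb.
have bG tm : 0 <= tm -> tm < T -> forall z, `|(g \o clamp tm) z| <= CG.
  by move=> tm0 tmT z; apply: gCG; exact: clamp_in.
have intF t x y : 0 < t -> t < T -> 0 <= x ->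
    iterated_integrable t (weighted a B be (g \o clamp t) x y) ->
    iterated_integrable t (F x y).
  move=> t0 tT x0; apply: eq_iterated_integrable => s yo /andP[s0 st].
  by apply: FE => //; rewrite s0 ltW.
split.
- move=> t x y [[]] /=; rewrite !in_itv/= andbT => /andP[t0 tT] x0 _.
  apply: intF => //; first exact: ltW.
  by apply: (iterated_integrable_interior cb t0 (cG _ _ _) CG_gt0 (bG _ _ _)) => //;
    exact: ltW.
- apply: intF => //.
  by apply: (iterated_integrable_boundary cb ts0 (cG _ _ _) CG_gt0 (bG _ _ _)) => //;
    exact: ltW.
pose tm := (tstar + T) / 2.
have tm_ts : tstar < tm by rewrite /tm; lra.
have tmT : tm < T by rewrite /tm; lra.
have tm0 : 0 < tm := lt_trans ts0 tm_ts.
have E t x y : t <= tm -> 0 <= x ->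
    \int[mu]_(s in `]0, t[) \int[mu]_(yo in setT) F x y s yo =
    \int[mu]_(s in `]0, t[) \int[mu]_(yo in setT)
      weighted a B be (g \o clamp tm) x y s yo.
  move=> ttm x0; apply: eq_Rintegral => s; rewrite inE /= in_itv/= => /andP[s0 st].
  apply: eq_Rintegral => yo _; rewrite FE// s0 /=.
  exact: le_trans (ltW st) ttm.
pose M := zone_ratio b C1.
(* all the conditions under which [boundary_limit] applies hold near the limit *)
pose P (p : R * R * R) := [/\ p.1.1 <= tm, p.1.2 <= 1, M * p.1.2 < p.1.1,
  `|p.2 - ystar| <= 1 & B ystar / 2 <= B p.2].
pose p0 : R * R * R := (tstar, 0, ystar).
have c1 : p.1.1 @[p --> p0] --> tstar.
  by apply: (@cvg_comp _ _ _ fst (fun q : R * R => q.1)); exact: cvg_fst.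
have c2 : p.1.2 @[p --> p0] --> (0 : R).
  apply: (@cvg_comp _ _ _ fst (fun q : R * R => q.2)); first exact: cvg_fst.
  exact: cvg_snd.
have c3 : p.2 @[p --> p0] --> ystar by exact: cvg_snd.
apply: (@cvg_within_seq _ _ _ D0 P).
  apply: cvg_within; rewrite -/p0 /P.
  have cM : p.1.1 - M * p.1.2 @[p --> p0] --> tstar - M * 0.
    by apply: cvgB => //; apply: cvgM => //; exact: cvg_cst.
  rewrite mulr0 subr0 in cM.
  have c4 : p.2 - ystar @[p --> p0] --> ystar - ystar.
    by apply: cvgB => //; exact: cvg_cst.
  rewrite subrr in c4.
  have cB : B p.2 @[p --> p0] --> B ystar.
    by apply: continuous_cvg c3; exact: coef_B_cont cb _.
  have By : B ystar / 2 < B ystar.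
    by have := coef_B_gt0 cb ystar; lra.
  near=> p; split.
  - by near: p; exact: (cvgr_le _ c1).
  - by near: p; apply: (cvgr_le _ c2).
  - by rewrite -subr_gt0; near: p; exact: (cvgr_gt _ cM).
  - by near: p; apply: (cvgr0_norm_le _ c4).
  - by near: p; exact: (cvgr_ge _ cB).
move=> u Du Pu cu.
have x_gt0 n : 0 < (u n).1.2.
  by have [[_]] := Du n; rewrite /= in_itv/= andbT.
rewrite E//; last exact: ltW.
have -> : g (0, 0, ystar, ystar) = (g \o clamp tm) (0, 0, ystar, ystar).
  by rewrite /= clamp_id// lexx ltW.
have -> : (fun n => \int[mu]_(s in `]0, (u n).1.1[) \int[mu]_(yo in setT)
      F (u n).1.2 (u n).2 s yo) =
    (fun n => \int[mu]_(s in `]0, (u n).1.1[) \int[mu]_(yo in setT)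
      weighted a B be (g \o clamp tm) (u n).1.2 (u n).2 s yo).
  by apply/funext => n; apply: E; [have [] := Pu n|exact: ltW].
apply: (boundary_limit cb tm0 (cG _ (ltW tm0) tmT) CG_gt0 (bG _ (ltW tm0) tmT)
  (t_ := fun n => (u n).1.1) (x_ := fun n => (u n).1.2) (y_ := fun n => (u n).2)).
- exact: ltW.
- exact: (cvg_comp _ _ cu c1).
- exact: (cvg_comp _ _ cu c2).
- exact: (cvg_comp _ _ cu c3).
- by move=> n; have [] := Pu n.
- by [].
- by move=> n; have [] := Pu n.
- by move=> n; have [] := Pu n.
- by move=> n; have [] := Pu n.
- by move=> n; have [] := Pu n.
Unshelve. all: by end_near.
Qed.
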